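(* Let $\varepsilon \leq 1/2$. Let $G$ be a (finite, simple) graph with demand function $f$ such that $f(v) \leq 1/(d(v) + 1 - \varepsilon)$ for each $v\in V(G)$ and $\sum_{v\in K}f(v) \leq 1$ for each clique $K\subseteq V(G)$. Then $G$ has an $f$-coloring.
   Context: A demand function for a graph $G$ is a function $f: V(G)\to [0,1]\cap\mathbb{Q}$. A fractional coloring of $G$ is a function $\phi$ assigning to each $v\in V(G)$ a measurable subset $\phi(v)\subseteq[0,1]$ such that $\phi(u)\cap\phi(v)=\varnothing$ for every edge $uv$. An $f$-coloring is a fractional coloring $\phi$ with $\mu(\phi(v))\geq f(v)$ for every $v$, where $\mu$ is Lebesgue measure. $d(v)$ denotes the degree of $v$. *)

(* Defs.v *)
From HB Require Import structures.
From mathcomp Require Import all_boot all_order all_algebra.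
From mathcomp Require Import all_classical all_reals all_analysis.
Set Implicit Arguments. Unset Strict Implicit. Unset Printing Implicit Defensive.
Import Order.TTheory GRing.Theory Num.Theory.
Local Open Scope classical_set_scope.
Local Open Scope ring_scope.

Definition simple_graph (T : finType) (e : rel T) : Prop :=
  symmetric e /\ irreflexive e.

Definition deg (T : finType) (e : rel T) (v : T) : nat := #|[set u | e v u]|.

Definition is_clique (T : finType) (e : rel T) (K : {set T}) : Prop :=
  forall u v, u \in K -> v \in K -> u != v -> e u v.

Definition demand (T : finType) (f : T -> rat) : Prop :=
  forall v, 0 <= f v <= 1.

Definition fractional_coloring (R : realType) (T : finType) (e : rel T)
    (phi : T -> set (measurableTypeR R)) : Prop :=
  (forall v, measurable (phi v)) /\
  (forall v, phi v `<=` `[0%R, 1%R]) /\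
  (forall u v, e u v -> phi u `&` phi v = set0).

Definition f_coloring (R : realType) (T : finType) (e : rel T) (f : T -> rat)
    (phi : T -> set (measurableTypeR R)) : Prop :=
  fractional_coloring e phi /\
  (forall v, ((ratr (f v) : R)%:E <= lebesgue_measure (phi v))%E).

(* Main.v *)
(* Colours may be taken from a finite set, [psi v] being a set of at least [f v * #|Om|]
   colours, and one argues by induction on the number of vertices. A vertex [v] with
   [sum f <= 1] over its closed neighbourhood can be deleted and coloured last. A clique on
   which [dem v := 1 / (d(v) + 1/2)] sums to at least 1 contains a vertex whose closed
   neighbourhood is that clique, so it gives such a [v]; otherwise one may assume
   [f = dem] and that every closed neighbourhood sum exceeds 1.

   Let [C] be a maximal clique among the vertices of minimum degree [d], [F := 1/(d + 1/2)],
   and remove [C]. The coloring of the rest extends to [C] as soon as at most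
   [1 - #|C| F] of the colours are blocked at every vertex of [C] simultaneously. Let [y]
   be an outer neighbour of [C] with [a] neighbours in [C], of degree [d + j].
   - If [a < #|C|] and [j < a], remove [y] too and then give it [F/2] too much; dropping
     the surplus colours of [y] at the right places unblocks enough of them.
   - If all such [y] see all of [C], two of them are nonadjacent. Replacing them and [C] by
     one new vertex of small demand forces their colour sets to overlap. The same device,
     applied to [y] and a non-neighbour of [y] in [C], settles the case that [a < #|C|] and
     that [y] and its neighbours outside [C] form a clique.
   - Otherwise the vertices [y] with [a < #|C|] can get the larger demand allowed by their
     degree outside [C]; dropping the surplus again unblocks colours, and averaging over
     the vertices of [C] shows that it unblocks enough of them. *)
From mathcomp Require Import all_boot all_order all_algebra.
From mathcomp Require Import ring lra zify.
Set Implicit Arguments. Unset Strict Implicit. Unset Printing Implicit Defensive.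
Import Order.TTheory GRing.Theory Num.Theory.

(** * Finite colorings *)

(** A vertex of degree [d] in a clique of size [c] has [d + 1 - c] neighbours outside and [c - 2]
    inside besides one left uncoloured. With itself this makes [d] portions of [q], while [M] is
    [d + 1/2] portions. *)
Lemma clique_room c d q s M : 1 < c -> c <= d + 1 -> s <= (d + 1 - c) * q ->
  2 * M = (2 * d + 1) * q -> (c - 2) * q + s + q <= M.
Proof.
move=> c1 cd.
have [k Ek] : exists k, c = k + 2 by exists (c - 2); lia.
have [l El] : exists l, d = k + 1 + l by exists (d - k - 1); lia.
subst c d; rewrite addnK (_ : k + 1 + l + 1 - (k + 2) = l); last by lia.
by move=> h1 h2; nia.
Qed.

Section FiniteColorings.
Variables (T Om : finType).
Implicit Types (e : rel T) (psi : T -> {set Om}) (C U W : {set T}).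

Definition proper e psi := forall u v, e u v -> [disjoint psi u & psi v].

Definition blk e psi v := \bigcup_(u | e v u) psi u.

Definition blocked e C psi := \bigcap_(w in C) blk e psi w.

Lemma disjoint_set0 (X : {set Om}) : [disjoint X & set0].
Proof. by rewrite disjoint_sym disjoints_subset sub0set. Qed.

Lemma set_interpolate (A B : {set Om}) k :
  A \subset B -> #|A| <= k <= #|B| ->
  exists X : {set Om}, [/\ A \subset X, X \subset B & #|X| = k].
Proof.
move=> sAB /andP[lAk lkB].
have : k - #|A| <= #|B :\: A| by rewrite cardsDS //; lia.
case/card_geqP => s [us ss sB]; exists (A :|: [set x in s]); split.
- exact: subsetUl.
- rewrite subUset sAB; apply/subsetP => x; rewrite inE => /sB.
  by rewrite inE => /andP[].
- rewrite cardsU (_ : A :&: _ = set0) ?cards0; last first.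
    apply/setP => x; rewrite !inE; apply/negP => /andP[xA /sB].
    by rewrite inE xA.
  by rewrite cardsE (card_uniqP us) ss; lia.
Qed.

Lemma card_bigcup_le (P : pred T) psi :
  #|\bigcup_(u | P u) psi u| <= \sum_(u | P u) #|psi u|.
Proof.
elim/big_rec2: _ => [|u m X _ IH]; first by rewrite cards0.
by apply: leq_trans (leq_card_setU _ _).1 _; rewrite leq_add2l.
Qed.

Lemma extend_at e psi v k : symmetric e -> irreflexive e -> proper e psi ->
  #|psi v| <= k -> #|blk e psi v| + k <= #|Om| ->
  exists psi', [/\ proper e psi', forall u, u != v -> psi' u = psi u,
    psi v \subset psi' v & #|psi' v| = k].
Proof.
move=> se ie pp lk lb.
have sv : psi v \subset ~: blk e psi v.
  apply/subsetP => x xv; rewrite inE; apply/bigcupP => -[u evu xu].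
  by move/disjointFr: (pp _ _ evu) => /(_ _ xv); rewrite xu.
have := cardsC (blk e psi v) => hC.
have [|X [vX Xb cX]] := set_interpolate sv (k := k); first by lia.
exists (fun u => if u == v then X else psi u); split.
- have dX u : e v u -> [disjoint X & psi u].
    move=> evu; rewrite disjoints_subset; apply: subset_trans Xb _.
    by rewrite setCS; apply: bigcup_sup.
  move=> u w euw; case: eqP => [uv|nu]; case: eqP => [wv|nw].
  + by move: euw; rewrite uv wv ie.
  + by apply: dX; rewrite -uv.
  + by rewrite disjoint_sym; apply: dX; rewrite -wv se.
  + exact: pp.
- by move=> u /negPf ->.
- by rewrite eqxx.
- by rewrite eqxx.
Qed.

(** The vertices of [W] are filled one after another. Since no set ever exceeds its bound [b], one
    condition on sums of [b] serves for every intermediate coloring. *)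
Lemma greedy_fill e psi (b : T -> nat) W : symmetric e -> irreflexive e ->
  proper e psi -> (forall u, #|psi u| <= b u) ->
  {in W, forall w, \sum_(u | e w u) b u + b w <= #|Om|} ->
  exists psi', [/\ proper e psi', forall u, u \notin W -> psi' u = psi u,
    forall u, psi u \subset psi' u & {in W, forall w, #|psi' w| = b w}].
Proof.
move=> se ie.
suff Ps : forall (s : seq T) psi, proper e psi -> (forall u, #|psi u| <= b u) ->
    {in s, forall w, \sum_(u | e w u) b u + b w <= #|Om|} ->
    exists psi', [/\ proper e psi', forall u, u \notin s -> psi' u = psi u,
      forall u, psi u \subset psi' u,
      (forall u, #|psi' u| <= b u) & {in s, forall w, #|psi' w| = b w}].
  move=> pp lb hW.
  have [w|psi' [p1 p2 p3 _ p5]] := Ps (enum W) _ pp lb.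
    by rewrite mem_enum => /hW.
  by exists psi'; split => // u; have := mem_enum W u => <-; [apply: p2 | apply: p5].
move=> s {}psi.
elim: s psi => [|w s IH] psi pp lb hW.
  by exists psi; split.
have [||psi1 [p1 q1 r1 c1]] := extend_at (v := w) (k := b w) se ie pp; first exact: lb.
  apply: leq_trans (hW w (mem_head _ _)); rewrite leq_add2r.
  by apply: leq_trans (card_bigcup_le _ _) _; apply: leq_sum => u _.
have lb1 u : #|psi1 u| <= b u.
  by have [->|/q1->] := eqVneq u w; rewrite ?c1.
have sub1 u : psi u \subset psi1 u.
  by have [->|/q1->] := eqVneq u w.
have [x xs|psi2 [p2 q2 r2 b2 c2]] := IH _ p1 lb1.
  by apply: hW; rewrite inE xs orbT.
exists psi2; split => //.
- by move=> u; rewrite inE negb_or => /andP[uw us]; rewrite q2 // q1.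
- by move=> u; apply: subset_trans (r2 u).
- move=> u; rewrite inE => /predU1P[->|/c2 //].
  by apply/eqP; rewrite eqn_leq b2 -c1 subset_leq_card.
Qed.

Lemma shrink_to psi (k : T -> nat) U :
  {in U, forall y, k y <= #|psi y|} ->
  exists psi', [/\ forall u, psi' u \subset psi u,
    forall u, u \notin U -> psi' u = psi u & {in U, forall y, #|psi' y| = k y}].
Proof.
move=> hk.
have ex y : exists X : {set Om},
    X \subset psi y /\ (if y \in U then #|X| == k y else X == psi y).
  case yU : (y \in U); last by exists (psi y).
  have [|X [_ sX cX]] := set_interpolate (sub0set (psi y)) (k := k y).
    by rewrite cards0 /= hk.
  by exists X; rewrite cX.
have [X0 X0P] := fin_all_exists ex.
exists X0; split => [u|u /negPf uU|u uU].
- by case: (X0P u).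
- by case: (X0P u) => _; rewrite uU => /eqP.
- by case: (X0P u) => _; rewrite uU => /eqP.
Qed.

Lemma blk_sub e psi psi' v :
  (forall u, psi' u \subset psi u) -> blk e psi' v \subset blk e psi v.
Proof.
move=> s; apply/bigcupsP => u evu; apply: subset_trans (s u) _.
exact: bigcup_sup.
Qed.

Lemma blocked_sub e C psi psi' :
  (forall u, psi' u \subset psi u) -> blocked e C psi' \subset blocked e C psi.
Proof.
move=> s; apply/bigcapsP => w wC.
by apply: subset_trans (bigcap_inf _ wC) (blk_sub _ _ s).
Qed.

Lemma proper_sub e psi psi' :
  (forall u, psi' u \subset psi u) -> proper e psi -> proper e psi'.
Proof. by move=> s pp u v /pp; apply: disjointW. Qed.

(* A colour blocked for all of [C] that no neighbour of [w] other than [y] uses is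
   blocked at [w] by [y] alone, so removing it from [y] unblocks it. *)
Lemma trim_blocked e psi C U (k : T -> nat) t :
  {in U, forall y, k y <= #|psi y|} ->
  {in U, forall y, exists2 w, w \in C & e w y} ->
  (forall y w, y \in U -> w \in C -> e w y ->
     \sum_(u | e w u && (u != y)) #|psi u| <= t) ->
  #|blocked e C psi| <= t + \sum_(y in U) (#|psi y| - k y) ->
  exists psi', [/\ forall u, psi' u \subset psi u,
    forall u, u \notin U -> psi' u = psi u, {in U, forall y, #|psi' y| = k y}
    & #|blocked e C psi'| <= t].
Proof.
have [m] := ubnP (\sum_(y in U) (#|psi y| - k y)).
elim: m psi => // m IH psi lm hk hC ht hB.
have [lBt|ltB] := leqP #|blocked e C psi| t.
  have [psi' [s1 s2 s3]] := shrink_to hk; exists psi'; split => //.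
  by apply: leq_trans lBt; rewrite subset_leq_card ?blocked_sub.
have : 0 < \sum_(y in U) (#|psi y| - k y) by lia.
rewrite lt0n sum_nat_eq0 negb_forall => /existsP[y].
rewrite negb_imply -lt0n subn_gt0 => /andP[yU lty].
have [w wC ewy] := hC _ yU.
have /subsetPn[x xB xN] :
    ~~ (blocked e C psi \subset \bigcup_(u | e w u && (u != y)) psi u).
  apply: contraL ltB => /subset_leq_card lB; rewrite -leqNgt.
  by rewrite (leq_trans lB) // (leq_trans (card_bigcup_le _ _)) // ht.
have xy : x \in psi y.
  have /bigcupP[u ewu xu] := subsetP (bigcap_inf _ wC) x xB.
  have [<- //|uy] := eqVneq u y.
  by case/negP: xN; apply/bigcupP; exists u; rewrite ?ewu.
pose psi1 u := if u == y then psi y :\ x else psi u.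
have s1 u : psi1 u \subset psi u.
  by rewrite /psi1; case: eqP => [->|//]; apply: subsetDl.
have c1 : #|psi1 y| = #|psi y|.-1.
  by rewrite /psi1 eqxx; have := cardsD1 x (psi y); rewrite xy; lia.
have n1 u : u != y -> psi1 u = psi u by rewrite /psi1 => /negPf->.
have S1 : (\sum_(u in U) (#|psi1 u| - k u)).+1 = \sum_(u in U) (#|psi u| - k u).
  rewrite (bigD1 y) //= [RHS](bigD1 y) //= c1 -addSn; congr (_ + _); first by lia.
  by apply: eq_bigr => u /andP[_ /n1->].
(* The surplus drops by exactly one and the blocked colours by at least one, so the counting
   hypothesis survives. *)
have B1 : #|blocked e C psi1| < #|blocked e C psi|.
  rewrite (cardsD1 x (blocked e C psi)) xB add1n ltnS subset_leq_card //.
  rewrite subsetD1 blocked_sub //=; apply/negP => /(subsetP (bigcap_inf _ wC)).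
  case/bigcupP => u ewu; have [->|uy] := eqVneq u y.
    by rewrite /psi1 eqxx !inE eqxx.
  rewrite n1 // => xu; case/negP: xN; apply/bigcupP; exists u => //.
  by rewrite ewu.
have [|z zU|y' w' yU' wC' ewy'||psi' [t1 t2 t3 t4]] := IH psi1 _ _ hC.
- by lia.
- have [->|/n1->] := eqVneq z y; last by apply: hk.
  by rewrite c1; lia.
- apply: leq_trans (ht _ _ yU' wC' ewy').
  by apply: leq_sum => u _; rewrite subset_leq_card.
- by lia.
exists psi'; split => //.
- by move=> u; apply: subset_trans (s1 u).
- by move=> u uU; rewrite t2 // n1 //; apply: contraNneq uU => ->.
Qed.

Lemma card_nb_out e C (w : T) : (forall x y, x \in C -> y \in C -> x != y -> e x y) ->
  irreflexive e -> w \in C ->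
  #|[set u | e w u]| + 1 = #|[set u | e w u & u \notin C]| + #|C|.
Proof.
move=> hC ie wC; rewrite -(cardsID C [set u | e w u]).
rewrite (_ : _ :&: C = C :\ w); last first.
  apply/setP => u; rewrite !inE; case: eqVneq => [->|uw] /=; first by rewrite ie.
  by case uC : (u \in C); rewrite ?andbF // hC // eq_sym.
rewrite (_ : _ :\: C = [set u | e w u & u \notin C]); last first.
  by apply/setP => u; rewrite !inE andbC.
by have := cardsD1 w C; rewrite wC; lia.
Qed.

(* Vertices of [C] other than [v] see only [d] demands of size [q]; the last one, [v],
   fits because enough colours blocked at [v] are first given to other vertices of [C]. *)
Lemma complete_clique e psi C d q : symmetric e -> irreflexive e ->
  proper e psi -> (forall x y, x \in C -> y \in C -> x != y -> e x y) ->
  {in C, forall w, psi w = set0} -> {in C, forall w, #|[set u | e w u]| = d} ->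
  2 * #|Om| = (2 * d + 1) * q ->
  (forall w u, w \in C -> e w u -> #|psi u| <= q) ->
  #|blocked e C psi| + #|C| * q <= #|Om| ->
  exists psi', [/\ proper e psi', forall u, u \notin C -> psi' u = psi u &
    {in C, forall w, #|psi' w| = q}].
Proof.
move=> se ie pp hC h0 hd hM hq hB.
have [->|[v vC]] := set_0Vmem C.
  by exists psi; split => // w; rewrite inE.
have hn w : w \in C -> #|[set u | e w u & u \notin C]| = d + 1 - #|C|.
  by move=> wC; have := card_nb_out hC ie wC; rewrite hd //; lia.
have cd : #|C| <= d + 1 by have := card_nb_out hC ie vC; rewrite hd //; lia.
have bsum w : w \in C ->
    \sum_(u | e w u && (u \notin C)) #|psi u| <= (d + 1 - #|C|) * q.
  move=> wC; rewrite -(hn _ wC) -sum1_card big_distrl /=.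
  under [X in _ <= X]eq_bigl do rewrite inE.
  by apply: leq_sum => u /andP[ewu _]; rewrite mul1n (hq w).
have bblk : #|blk e psi v| <= (d + 1 - #|C|) * q.
  apply: leq_trans (card_bigcup_le _ _) _; apply: leq_trans (bsum _ vC).
  rewrite (bigID (fun u => u \in C)) /= big1 ?add0n // => u /andP[_ uC].
  by rewrite h0 ?cards0.
(* Without repetitions [v] would be short of [m] colours. The set [X] below collects [m] colours
   blocked at [v] that are used again inside [C]. *)
set m := #|C| * q + #|blk e psi v| - #|Om|.
have sB : blocked e C psi \subset blk e psi v by apply: bigcap_inf.
have lm : m <= #|blk e psi v :\: blocked e C psi|.
  by rewrite cardsDS // /m; have := subset_leq_card sB; lia.
(* Outer neighbours block at most [(d + 1 - #|C|) * q] colours and [#|Om|] is [d + 1/2] portions of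
   [q], so [m] is at most [q / 2]. *)
have mq : m <= q by rewrite /m; nia.
have [|X [_ sX cX]] := set_interpolate (sub0set _) (k := m) (B := blk e psi v :\: blocked e C psi).
  by rewrite cards0 lm.
(* A colour that is not blocked on all of [C] is free at some vertex [g x] of [C], which is not [v]
   because the colour is blocked at [v]. *)
have exw x : exists w, x \in X -> (w \in C) && (x \notin blk e psi w).
  case xX : (x \in X); last by exists v.
  have := subsetP sX x xX; rewrite inE => /andP[/bigcapP nx _].
  case: (pickP (fun w => (w \in C) && (x \notin blk e psi w))) => [w hw|no].
    by exists w.
  by case: nx => w wC; have := no w; rewrite wC /= => /negbFE.
have [g gP] := fin_all_exists exw.
have gv x : x \in X -> g x != v.
  move=> xX; have /andP[_] := gP x xX; apply: contraNneq => ->.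
  by have := subsetP sX x xX; rewrite inE => /andP[].
pose psi1 u := if u \in C then [set x in X | g x == u] else psi u.
have pp1 : proper e psi1.
  have dX u w : u \in C -> w \notin C -> e u w ->
      [disjoint [set x in X | g x == u] & psi w].
    move=> uC wC euw; rewrite disjoints_subset; apply/subsetP => x.
    rewrite !inE => /andP[xX /eqP gx]; have /andP[_] := gP x xX.
    by rewrite gx; apply: contra => xw; apply/bigcupP; exists w.
  move=> u w euw; rewrite /psi1; case: ifPn => uC; case: ifPn => wC.
  - rewrite disjoints_subset; apply/subsetP => x; rewrite !inE => /andP[-> /eqP->] /=.
    by apply: contraTneq euw => ->; rewrite ie.
  - exact: dX.
  - by rewrite disjoint_sym; apply: dX => //; rewrite se.
  - exact: pp.
(* The bound 0 keeps [v] uncoloured while the rest of [C] is filled. *)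
pose b u := if u \in C then (if u == v then 0 else q) else #|psi u|.
have [u|w|psi2 [p2 q2 r2 c2]] := greedy_fill (b := b) (W := C :\ v) se ie pp1.
- rewrite /psi1 /b; case: ifP => // uC; case: eqP => [->|_].
    rewrite leqn0 cards_eq0; apply/eqP/setP => x; rewrite !inE.
    by apply/negP => /andP[/gv/negP].
  apply: leq_trans mq; rewrite -cX; apply: subset_leq_card.
  by apply/subsetP => x; rewrite inE => /andP[].
- rewrite !inE => /andP[wv wC]; rewrite {2}/b wC (negPf wv).
  rewrite (bigID (fun u => u \in C)) /=.
  have -> : \sum_(u | e w u && (u \in C)) b u = (#|C| - 2) * q.
    rewrite (eq_bigl [in C :\ w]) => [|u]; last first.
      rewrite !inE; case: (eqVneq u w) => [->|uw] /=; first by rewrite ie.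
      by case uC : (u \in C); rewrite ?andbF // (hC w) // eq_sym.
    rewrite (big_setD1 v) ?inE 1?eq_sym ?wv //= {1}/b vC eqxx add0n.
    rewrite (eq_bigr (fun=> q)) => [|u]; last first.
      by rewrite !inE => /and3P[/negPf uv _ uC]; rewrite /b uC uv.
    rewrite sum_nat_const; congr (_ * _).
    have := cardsD1 w C; have := cardsD1 v (C :\ w); rewrite !inE vC wC eq_sym wv /=.
    by lia.
  have c2 : 2 <= #|C|.
    have := cardsD1 v C; have := cardsD1 w (C :\ v); rewrite !inE vC wC wv /=.
    by lia.
  have := bsum _ wC; rewrite (eq_bigr b) => [hb|u /andP[_ /negPf uC]]; last first.
    by rewrite /b uC.
  exact: clique_room hM.
have h2 u : u \notin C -> psi2 u = psi u.
  by move=> uC; rewrite q2 /psi1 ?(negPf uC) // !inE (negPf uC) andbF.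
have v20 : psi2 v = set0.
  rewrite q2 ?inE ?eqxx // /psi1 vC; apply/setP => x; rewrite !inE.
  by apply/negP => /andP[/gv/negP].
have [||psi3 [p3 q3 r3 c3]] := extend_at (k := q) (v := v) se ie p2.
- by rewrite v20 cards0.
(* The colours of [X] lie both in [Z] and in [blk e psi v], so the union of these two loses [m]
   elements. *)
- pose Z := \bigcup_(u in C :\ v) psi2 u.
  have lZ : #|Z| <= (#|C| - 1) * q.
    apply: leq_trans (card_bigcup_le _ _) _.
    rewrite (eq_bigr (fun=> q)) => [|u uC]; last first.
      by rewrite c2 // /b; move: uC; rewrite !inE => /andP[/negPf-> ->].
    by rewrite sum_nat_const (cardsD1 v C) vC; lia.
  have XZ : X \subset Z.
    apply/subsetP => x xX; have /andP[gC _] := gP x xX.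
    apply/bigcupP; exists (g x); first by rewrite !inE gv.
    by apply: (subsetP (r2 _)); rewrite /psi1 gC !inE xX eqxx.
  have Xb : X \subset blk e psi v by apply: subset_trans sX (subsetDl _ _).
  have : #|blk e psi2 v| <= #|blk e psi v :|: (Z :\: X)|.
    apply: subset_leq_card; apply/bigcupsP => u evu.
    have [uC|uC] := boolP (u \in C); last first.
      by rewrite h2 //; apply: subset_trans (subsetUl _ _); apply: bigcup_sup.
    apply: (@subset_trans _ _ (mem Z)).
      apply: bigcup_sup; rewrite !inE uC andbT.
      by apply: contraTneq evu => ->; rewrite ie.
    apply/subsetP => x xZ; rewrite !inE xZ andbT.
    by case xX : (x \in X); rewrite ?orbT // (subsetP Xb).
  have := (leq_card_setU (blk e psi v) (Z :\: X)).1.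
  rewrite cardsDS // cX => l1 l2.
  have Eq : (#|C| - 1) * q + q = #|C| * q.
    by rewrite (cardsD1 v) vC add1n subn1 /= mulSn addnC.
  have := subset_leq_card XZ; rewrite cX => l3.
  move: Eq l1 l2 l3 lZ; rewrite /m; move: (_ * q) => z; clear.
  by lia.
exists psi3; split => // [u uC|w wC].
  by rewrite q3 ?h2 //; apply: contraNneq uC => ->.
have [->//|wv] := eqVneq w v.
by rewrite q3 // c2 ?inE ?wv // /b wC (negPf wv).
Qed.

End FiniteColorings.

Local Open Scope ring_scope.

(** * Reduction to tight graphs *)

Section Demands.
Variable T : finType.
Implicit Types (e : rel T) (A C K S U : {set T}) (f : T -> rat) (u v w y : T).

Definition nb e v := [set u | e v u].
Definition dg e v := #|nb e v|.
Definition clique e K := [forall u in K, forall v in K, (u != v) ==> e u v].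
Definition dem e v : rat := 2 / (2 * (dg e v)%:R + 1).
Definition restr e S : rel T := fun u v => [&& e u v, u \notin S & v \notin S].

Lemma cliqueP e K :
  reflect (forall u v, u \in K -> v \in K -> u != v -> e u v) (clique e K).
Proof.
apply: (iffP forall_inP) => [h u v uK vK uv|h u uK].
  by have /forall_inP/(_ _ vK)/implyP := h u uK; apply.
by apply/forall_inP => v vK; apply/implyP; apply: h.
Qed.

Definition edges_in A e := forall u v, e u v -> u \in A.

(* Vertices are deleted by shrinking [A] and the edge relation, never the type [T]. *)
Record good A e f : Prop := Good {
  good_sym : symmetric e;
  good_irr : irreflexive e;
  good_edges : edges_in A e;
  good_ge0 : {in A, forall v, 0 <= f v};
  good_dem : {in A, forall v, f v <= dem e v};
  good_clique : forall K, K \subset A -> clique e K -> \sum_(v in K) f v <= 1 }.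

(** One colour stands for a share [1 / #|Om|] of the unit interval, hence the nonempty [Om]. *)
Definition colorable A e f := exists (Om : finType) (psi : T -> {set Om}),
  [/\ (0 < #|Om|)%N, proper e psi &
      {in A, forall v, f v * #|Om|%:R <= #|psi v|%:R}].

(** * Exact demands by clearing denominators *)

Lemma ratnat_denq (x : rat) (M : nat) : 0 <= x -> (`|denq x| %| M)%N ->
  exists k : nat, k%:R = x * M%:R.
Proof.
move=> x0 /dvdnP[k ->]; exists (`|numq x| * k)%N.
rewrite -{2}(divq_num_den x) natrM natrM mulrC [RHS]mulrC -mulrA; congr (_ * _).
have -> : (`|denq x|%N)%:R = (denq x)%:~R :> rat.
  by rewrite pmulrn gez0_abs // ltW // denq_gt0.
have -> : (`|numq x|%N)%:R = (numq x)%:~R :> rat.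
  by rewrite pmulrn gez0_abs // numq_ge0.
by rewrite mulrC divfK // intr_eq0 denq_neq0.
Qed.

Lemma colorable_exact A e f D : colorable A e f -> {in A, forall v, 0 <= f v} ->
  (0 < D)%N -> exists (Om : finType) (psi : T -> {set Om}),
  [/\ (0 < #|Om|)%N, (D %| #|Om|)%N, proper e psi,
      {in A, forall v, #|psi v|%:R = f v * #|Om|%:R} &
      forall v, v \notin A -> psi v = set0].
Proof.
move=> [Om [psi [Om0 pp hf]]] f0 D0.
pose B := (D * \prod_v `|denq (f v)|)%N.
have B0 : (0 < B)%N.
  rewrite muln_gt0 D0; apply: prodn_gt0 => v.
  by rewrite absz_gt0 denq_neq0.
exists (Om * 'I_B)%type.
have cM : #|{: Om * 'I_B}| = (#|Om| * B)%N by rewrite card_prod card_ord.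
pose psi1 v : {set Om * 'I_B} := if v \in A then setX (psi v) setT else set0.
have p1 : proper e psi1.
  move=> u v /pp duv; rewrite /psi1; case: ifP => _; last by rewrite disjoints_subset sub0set.
  case: ifP => _; last by rewrite disjoint_sym disjoints_subset sub0set.
  rewrite disjoints_subset; apply/subsetP => -[x i]; rewrite !inE !andbT => xu.
  by rewrite (disjointFr duv).
have exk v : exists k : nat, v \in A -> k%:R = f v * #|{: Om * 'I_B}|%:R.
  case vA : (v \in A); last by exists 0%N.
  have [|k kP] := ratnat_denq (M := #|{: Om * 'I_B}|) (f0 v vA).
    by rewrite cM !dvdn_mull // (bigD1 v) //= dvdn_mulr.
  by exists k.
have [k kP] := fin_all_exists exk.
have [v vA|psi2 [s2 n2 c2]] := shrink_to (psi := psi1) (k := k) (U := A).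
  rewrite -(ler_nat rat) kP // /psi1 vA cardsX cardsT card_ord cM !natrM mulrA.
  by apply: ler_wpM2r; [rewrite mulr_ge0 | apply: hf].
exists psi2; split.
- by rewrite cM muln_gt0 Om0.
- by rewrite cM dvdn_mull // dvdn_mulr.
- exact: proper_sub p1.
- by move=> v vA; rewrite c2 // kP.
- by move=> v vA; rewrite n2 // /psi1 (negPf vA).
Qed.

(** * Deleting vertices *)

Lemma dem_gt0 e v : 0 < dem e v.
Proof. by rewrite divr_gt0 // ltr_wpDl // mulr_ge0. Qed.

Lemma dem_le e e' u v : (dg e v <= dg e' u)%N -> dem e' u <= dem e v.
Proof.
move=> h; rewrite ler_pM2l // lef_pV2 ?posrE ?ltr_wpDl ?mulr_ge0 //.
by rewrite lerD2r ler_pM2l // ler_nat.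
Qed.

Lemma nb_restr e S v : v \notin S -> nb (restr e S) v = nb e v :\: S.
Proof. by move=> vS; apply/setP => u; rewrite !inE /restr vS /= andbC. Qed.

Lemma restr_sym e S : symmetric e -> symmetric (restr e S).
Proof. by move=> s u v; rewrite /restr s; congr (_ && _); rewrite andbC. Qed.

Lemma restr_irr e S : irreflexive e -> irreflexive (restr e S).
Proof. by move=> i u; rewrite /restr i. Qed.

Lemma restr_edges A e S : edges_in A e -> edges_in (A :\: S) (restr e S).
Proof. by move=> h u v /and3P[/h uA uS _]; rewrite inE uS. Qed.

Lemma restr_clique e S K : clique (restr e S) K -> clique e K.
Proof.
by move/cliqueP => h; apply/cliqueP => u v uK vK /(h u v uK vK) /and3P[].
Qed.

Lemma dg_restr_le e S v : v \notin S -> (dg (restr e S) v <= dg e v)%N.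
Proof. by move=> vS; rewrite /dg nb_restr // subset_leq_card ?subsetDl. Qed.

Lemma good_restr A e f S : good A e f -> good (A :\: S) (restr e S) f.
Proof.
case=> s i ed g0 gd gc; split.
- exact: restr_sym.
- exact: restr_irr.
- exact: restr_edges.
- by move=> v /setDP[/g0].
- by move=> v /setDP[/gd h vS]; apply: le_trans h _; apply/dem_le/dg_restr_le.
- move=> K sK cK; apply: gc; first exact: subset_trans sK (subsetDl _ _).
  exact: restr_clique cK.
Qed.

Lemma proper_restr (Om : finType) e S (psi : T -> {set Om}) :
  proper (restr e S) psi -> {in S, forall v, psi v = set0} -> proper e psi.
Proof.
move=> pp h0 u v euv; have [uS|uS] := boolP (u \in S).
  by rewrite h0 // disjoints_subset sub0set.
have [vS|vS] := boolP (v \in S).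
  by rewrite (h0 v) // disjoint_sym disjoints_subset sub0set.
by apply: pp; rewrite /restr euv uS.
Qed.

Lemma colorable_le A e f g : {in A, forall v, f v <= g v} ->
  colorable A e g -> colorable A e f.
Proof.
move=> h [Om [psi [Om0 pp hg]]]; exists Om, psi; split => // v vA.
by apply: le_trans (hg v vA); rewrite ler_wpM2r // h.
Qed.

Lemma subset_proper_card A S v : v \in A -> v \in S -> (#|A :\: S| < #|A|)%N.
Proof.
move=> vA vS; apply: proper_card; rewrite properEneq subsetDl andbT.
by apply: contraTneq vA => <-; rewrite inE vS.
Qed.

(** The neighbours of [v] hold exactly their demands, so by the sum condition at least [f v * #|Om|]
    colours remain for [v]. *)
Lemma delete_vertex A e f v : good A e f -> v \in A ->
  \sum_(u | e v u) f u + f v <= 1 ->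
  colorable (A :\: [set v]) (restr e [set v]) f -> colorable A e f.
Proof.
move=> gd vA sv col; have [se ie ed g0 _ _] := gd.
have [Om [psi [Om0 dv pp hf h0]]] := colorable_exact (D := `|denq (f v)|) col
  (good_ge0 (good_restr [set v] gd)) (ltac: (by rewrite absz_gt0 denq_neq0)).
have [k kP] := ratnat_denq (g0 v vA) dv.
have pv : psi v = set0 by rewrite h0 // !inE eqxx.
have {}pp : proper e psi.
  by apply: proper_restr pp _ => u /set1P->.
have hu u : e v u -> #|psi u|%:R = f u * #|Om|%:R.
  move=> evu; rewrite hf // !inE (ed u v) ?(se u) // andbT.
  by apply: contraTneq evu => ->; rewrite ie.
pose b u := if u == v then k else #|psi u|.
have [u|w|psi' [p1 n1 s1 c1]] := greedy_fill (b := b) (W := [set v]) se ie pp.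
- by rewrite /b; case: eqP => // ->; rewrite pv cards0.
- move=> /set1P->; rewrite -(ler_nat rat) natrD natr_sum {2}/b eqxx kP.
  rewrite (eq_bigr (fun u => f u * #|Om|%:R)) => [|u evu]; last first.
    by rewrite /b ifN ?hu //; apply: contraTneq evu => ->; rewrite ie.
  by rewrite -mulr_suml -mulrDl ler_piMl.
exists Om, psi'; split => // u uA.
have [->|uv] := eqVneq u v; first by rewrite c1 ?inE // /b eqxx kP.
by rewrite n1 ?inE // hf // !inE uv.
Qed.

(** If every [g v] were at least [#|K|], the sum would be at most [2 #|K| / (2 #|K| + 1)], below 1.
    The function [g] is arbitrary so that degrees from two different graphs can be mixed. *)
Lemma light_vertex K (g : T -> nat) : K != set0 ->
  1 <= \sum_(v in K) 2 / (2 * (g v)%:R + 1) :> rat ->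
  exists2 v, v \in K & (g v < #|K|)%N.
Proof.
move=> K0 sK.
apply/exists_inP; apply: contraLR sK => /exists_inPn h; rewrite -ltNge.
have {}h v : v \in K -> (#|K| <= g v)%N by move/h; rewrite -leqNgt.
have K1 : (0 < #|K|)%N by rewrite card_gt0.
apply: le_lt_trans (_ : \sum_(v in K) 2 / (2 * #|K|%:R + 1) < 1).
  apply: ler_sum => v /h hv; rewrite ler_pM2l // lef_pV2 ?posrE ?ltr_wpDl ?mulr_ge0 //.
  by rewrite lerD2r ler_pM2l // ler_nat.
rewrite sumr_const -[_ *+ #|K|]mulr_natr.
have : 0 < #|K|%:R :> rat by rewrite ltr0n.
move: #|K|%:R => x x0; rewrite mulrAC ltr_pdivrMr; lra.
Qed.

Lemma clique_closed_nb e K v : irreflexive e -> clique e K -> v \in K ->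
  (dg e v < #|K|)%N -> K = v |: nb e v.
Proof.
move=> ie /cliqueP cK vK dv; apply/eqP; rewrite eqEcard; apply/andP; split.
  by apply/subsetP => u uK; rewrite !inE; case: eqVneq => //= uv; rewrite cK // eq_sym.
by rewrite cardsU1 inE ie.
Qed.

(** The irreducible instances: [dem] leaves slack on every clique, yet no vertex can be deleted and
    coloured last. *)
Definition tight A e := [/\ symmetric e, irreflexive e, edges_in A e,
  forall K, K \subset A -> clique e K -> \sum_(v in K) dem e v < 1 &
  {in A, forall v, 1 < \sum_(u | e v u) dem e u + dem e v}].

Lemma tight_good A e : tight A e -> good A e (dem e).
Proof.
move=> [se ie ed hK _]; split => //; first by move=> v _; apply/ltW/dem_gt0.
by move=> K sK /(hK K sK)/ltW.
Qed.

Lemma nb_sub A e v : symmetric e -> edges_in A e -> nb e v \subset A.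
Proof. by move=> se ed; apply/subsetP => u; rewrite inE se => /ed. Qed.

Lemma reduce_to_tight A e f :
  (forall A' e' f', (#|A'| < #|A|)%N -> good A' e' f' -> colorable A' e' f') ->
  (tight A e -> colorable A e (dem e)) -> good A e f -> colorable A e f.
Proof.
move=> IH ht gd; have [se ie ed g0 gdm gc] := gd.
have del g v : good A e g -> v \in A -> \sum_(u | e v u) g u + g v <= 1 -> colorable A e g.
  move=> gg vA sv; apply: (delete_vertex gg vA sv); apply: IH.
    by apply: (subset_proper_card vA); rewrite inE.
  exact: good_restr.
case: (pickP (fun K => [&& K \subset A, clique e K & 1 <= \sum_(v in K) dem e v])).
  move=> K /and3P[sK cK sum1].
  have K0 : K != set0 by apply: contraTneq sum1 => ->; rewrite big_set0 ler10.
  have [v vK dv] := light_vertex K0 sum1.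
  have EK := clique_closed_nb ie cK vK dv.
  apply: (del f v) => //; first exact: (subsetP sK).
  have := gc K sK cK; rewrite EK big_setU1 ?inE ?ie //= addrC.
  by rewrite (eq_bigl (e v)) // => u; rewrite inE.
move=> noK.
(* With no heavy clique left, [dem] is itself admissible and dominates [f], so it may replace
   [f]. *)
have gdd : good A e (dem e).
  split => // [v _|K sK cK]; first exact/ltW/dem_gt0.
  by have := noK K; rewrite sK cK /= => /negbT; rewrite -ltNge => /ltW.
apply: (colorable_le gdm).
case: (pickP (fun v => (v \in A) && (\sum_(u | e v u) dem e u + dem e v <= 1))).
  by move=> v /andP[vA sv]; apply: (del _ v).
move=> nov; apply: ht; split => //.
  by move=> K sK cK; have := noK K; rewrite sK cK /= => /negbT; rewrite -ltNge.
by move=> v vA; have := nov v; rewrite vA /= => /negbT; rewrite -ltNge.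
Qed.

(* The factorial makes every demand [dem e v * M] that occurs an integer. *)
Lemma fact_dem e v M : ((2 * #|T| + 1)`! %| M)%N ->
  exists k : nat, k%:R = dem e v * M%:R.
Proof.
move=> dM; have : (2 * dg e v + 1 %| M)%N.
  apply: dvdn_trans dM; apply: dvdn_fact.
  have : (dg e v <= #|T|)%N by apply: max_card.
  by lia.
case/dvdnP => k ->; exists (2 * k)%N; rewrite /dem !natrM natrD natrM.
by field; rewrite gt_eqF // ltr_wpDl // mulr_ge0.
Qed.

(** [p] itself plays the new vertex; the other vertices of [S] become isolated. *)
Definition merge e S p q : rel T := fun u v =>
  [|| [&& e u v, u \notin S & v \notin S],
      [&& u == p, v \notin S & e p v || e q v] |
      [&& v == p, u \notin S & e p u || e q u]].

(* Colouring the graph where [S] is replaced by a single vertex of demand [del],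
   adjacent to all outer neighbours of [p] and [q], reserves a set [Z] of colours that
   both [p] and [q] may still use. *)
Lemma pair_gadget A e S p q (del : rat) D : tight A e ->
  (forall A' e' f', (#|A'| < #|A|)%N -> good A' e' f' -> colorable A' e' f') ->
  S \subset A -> p \in S -> q \in S -> p != q -> 0 <= del ->
  del * (2 * #|(nb e p :|: nb e q) :\: S|%:R + 1) <= 1 -> (0 < D)%N ->
  exists (Om : finType) (psi : T -> {set Om}) (Z : {set Om}),
  [/\ [/\ (0 < #|Om|)%N, (D %| #|Om|)%N & proper e psi],
      {in A :\: S, forall v, #|psi v|%:R = dem e v * #|Om|%:R},
      forall v, v \notin A :\: S -> psi v = set0, #|Z|%:R = del * #|Om|%:R &
      forall u, u \notin S -> e p u || e q u -> [disjoint Z & psi u]].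
Proof.
move=> ti IH sS pS qS pq del0 hdel D0; have [se ie ed hK _] := ti.
pose A' := p |: (A :\: S); pose e' := merge e S p q.
pose f' u := if u == p then del else dem e u.
have nS u : u \notin S -> u != p by apply: contraNneq => ->.
have seq' : symmetric e'.
  move=> u v; rewrite /e' /merge (se u v).
  by congr orb; [congr andb; apply: andbC | apply: orbC].
have ep u : e' p u = (u \notin S) && (e p u || e q u).
  by rewrite /e' /merge eqxx pS /= !andbF orbF.
have eu u v : u \notin S -> v \notin S -> e' u v = e u v.
  by move=> uS vS; rewrite /e' /merge uS vS (negPf (nS _ uS)) (negPf (nS _ vS)) !andbT !orbF.
have ie' : irreflexive e'.
  move=> u; have [->|up] := eqVneq u p; first by rewrite ep pS.
  by rewrite /e' /merge ie (negPf up).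
have pA : p \in A by apply: (subsetP sS).
have qA : q \in A by apply: (subsetP sS).
have ed' : edges_in A' e'.
  move=> u v; rewrite !inE => /or3P[/and3P[/ed -> -> _]|/andP[->]//|/and3P[_ uS]].
    by rewrite orbT.
  by rewrite uS !(se _ u) => /orP[]/ed->; rewrite orbT.
have dp : dg e' p = #|(nb e p :|: nb e q) :\: S|.
  by apply: eq_card => u; rewrite !inE ep.
have dem_m (m : nat) v : (m <= dg e v)%N -> dem e v <= 2 / (2 * m%:R + 1).
  move=> h; rewrite ler_pM2l // lef_pV2 ?posrE ?ltr_wpDl ?mulr_ge0 //.
  by rewrite lerD2r ler_pM2l // ler_nat.
have dgl v : v \notin S -> (dg e' v <= dg e v)%N.
  (* The edge from [v] to the new vertex replaces an edge to [p] or [q], namely to [r], so no outer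
     degree grows. *)
  move=> vS; pose r := if e p v then p else q.
  have e'p : e' v p -> e v r.
    by rewrite seq' ep vS /r => /=; case: ifP => [|_ /=]; rewrite se.
  have rS : r \in S by rewrite /r; case: ifP.
  have [vp|vp] := boolP (e' v p); last first.
    apply/subset_leq_card/subsetP => u; rewrite !inE => vu.
    have [up|up] := eqVneq u p; first by rewrite -up vu in vp.
    move: vu; rewrite /e' /merge (negPf up) (negPf (nS _ vS)) /= !orbF.
    by case/andP.
  rewrite /dg (cardsD1 p) inE vp (cardsD1 r (nb e v)) inE (e'p vp) !add1n ltnS.
  apply/subset_leq_card/subsetP => u; rewrite !inE => /andP[up].
  rewrite /e' /merge (negPf up) (negPf (nS _ vS)) /= orbF => /and3P[-> _ uS].
  by rewrite andbT; apply: contraNneq uS => ->.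
have gd' : good A' e' f'.
  split => //.
  - by move=> v _; rewrite /f'; case: ifP => _ //; apply/ltW/dem_gt0.
  - move=> v; rewrite /f' => /setU1P[->|/setDP[vA vS]].
      rewrite eqxx /dem dp ler_pdivlMr; last by rewrite ltr_wpDl // mulr_ge0.
      by apply: le_trans hdel _.
    by rewrite (negPf (nS _ vS)); apply/dem_le/dgl.
  - move=> K sK /cliqueP cK.
    have KS u : u \in K :\ p -> (u \in A) && (u \notin S).
      move=> /setD1P[up uK]; have := subsetP sK u uK.
      by rewrite !inE (negPf up) /= andbC.
    have cK' : clique e (K :\ p).
      apply/cliqueP => u v uK vK uv; have /andP[_ uS] := KS u uK.
      have /andP[_ vS] := KS v vK.
      by rewrite -eu //; apply: cK => //; [case/setD1P: uK|case/setD1P: vK].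
    have E : \sum_(v in K :\ p) f' v = \sum_(v in K :\ p) dem e v.
      by apply: eq_bigr => v /setD1P[vp _]; rewrite /f' (negPf vp).
    have sK' : K :\ p \subset A by apply/subsetP => u /KS/andP[].
    have [pK|pK] := boolP (p \in K); last first.
      have EK : K :\ p = K.
        by apply/setP => u; rewrite !inE; case: eqVneq => // ->; rewrite (negPf pK).
      by rewrite -EK E; apply/ltW/hK.
    rewrite (big_setD1 p) //= E {1}/f' eqxx.
    (* All [m + 1] vertices of the clique have degree at least [m]. As [del] is at most half the
       usual demand, the sum is at most [(1 + 2 m) / (2 m + 1) = 1]. *)
    set m := #|K :\ p|.
    have mD : (m <= dg e' p)%N.
      apply/subset_leq_card/subsetP => u /setD1P[up uK].
      by rewrite inE cK // eq_sym.
    have dm v : v \in K :\ p -> (m <= dg e v)%N.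
      move=> vK; have /andP[_ vS] := KS v vK; apply: leq_trans (dgl v vS).
      have /setD1P[vp vK'] := vK.
      have -> : m = #|K :\ v|.
        by have := cardsD1 p K; rewrite (cardsD1 v K) pK vK' => /addnI.
      apply/subset_leq_card/subsetP => u /setD1P[uv uK].
      by rewrite inE cK // eq_sym.
    have ld : del <= 1 / (2 * m%:R + 1).
      rewrite ler_pdivlMr; last by rewrite ltr_wpDl // mulr_ge0.
      apply: le_trans hdel; rewrite ler_wpM2l // lerD2r ler_pM2l // ler_nat.
      by rewrite -dp.
    have ls : \sum_(v in K :\ p) dem e v <= \sum_(v in K :\ p) 2 / (2 * m%:R + 1).
      by apply: ler_sum => v vK; apply/dem_m/dm.
    apply: le_trans (lerD ld ls) _.
    rewrite sumr_const -/m -[X in _ + X]mulr_natr.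
    have : 0 <= m%:R :> rat by [].
    move: m%:R => x x0; rewrite mulrAC -mulrDl ler_pdivrMr; lra.
have lA' : (#|A'| < #|A|)%N.
  rewrite (cardsD1 q A) qA add1n ltnS; apply/subset_leq_card/subsetP => u.
  rewrite !inE => /orP[/eqP->|/andP[uS ->]]; first by rewrite pq.
  by rewrite andbT; apply: contraNneq uS => ->.
have [Om [psi [Om0 dv pp hf h0]]] := colorable_exact (IH _ _ _ lA' gd') (good_ge0 gd') D0.
pose psi1 u := if u == p then set0 else psi u.
exists Om, psi1, (psi p); split; first (split => //).
- move=> u v euv; rewrite /psi1; case: eqP => [_|/eqP up].
    by rewrite disjoints_subset sub0set.
  case: eqP => [_|/eqP vp]; first by rewrite disjoint_sym disjoints_subset sub0set.
  have [uS|uS] := boolP (u \in S).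
    by rewrite h0 ?disjoints_subset ?sub0set // !inE (negPf up) uS.
  have [vS|vS] := boolP (v \in S).
    by rewrite disjoint_sym h0 ?disjoints_subset ?sub0set // !inE (negPf vp) vS.
  by apply: pp; rewrite eu.
- move=> v vAS; have /setDP[vA vS] := vAS; rewrite /psi1 (negPf (nS _ vS)) hf.
    by rewrite /f' (negPf (nS _ vS)).
  by rewrite inE vAS orbT.
- move=> v vAS; rewrite /psi1; case: eqP => // /eqP vp.
  by rewrite h0 // inE (negPf vAS) inE (negPf vp).
- by rewrite hf ?inE ?eqxx // /f' eqxx.
- move=> u uS epu; rewrite /psi1 (negPf (nS _ uS)); apply: pp.
  by rewrite ep uS.
Qed.

End Demands.

(** * Tight graphs *)

(** The map sending [x] to [2 / N - 2 / (N + 2 x)] is concave and vanishes at 0. *)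
Lemma deficit_subadd (N x y : rat) : 0 < N -> 0 <= x -> 0 <= y ->
  2 / N - 2 / (N + 2 * (x + y)) <= (2 / N - 2 / (N + 2 * x)) + (2 / N - 2 / (N + 2 * y)).
Proof.
move=> N0 x0 y0; rewrite -subr_ge0.
have -> : 2 / N - 2 / (N + 2 * x) + (2 / N - 2 / (N + 2 * y)) -
    (2 / N - 2 / (N + 2 * (x + y))) =
    2 * (2 * x) * (2 * y) * (2 * N + 2 * x + 2 * y) /
    (N * (N + 2 * x) * (N + 2 * y) * (N + 2 * (x + y))).
  field; rewrite !gt_eqF //; lra.
by rewrite divr_ge0 // !mulr_ge0 //; lra.
Qed.

(** Here [N = 2 d + 1], [n] counts the outer neighbours of a clique vertex, and an outer vertex has
    [a] neighbours in the clique and degree [d + j]. Raising its demand helps the [c - a] clique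
    vertices it does not see, and its deficit against [2 / N] helps the other [a]; [4 / (N (N + 2))]
    is the deficit for [j = 1]. *)
Lemma raise_gain (N n c a j : rat) : 0 < N -> 2 * c = N + 1 - 2 * n -> 1 <= n ->
  1 <= a -> a + 1 <= c -> a <= j ->
  a * (1 / N - (n - 1) * (4 / (N * (N + 2)))) <=
  (c - a) * (2 / (N + 2 * (j - a)) - 2 / (N + 2 * j)) + a * (2 / N - 2 / (N + 2 * j)).
Proof.
move=> N0 Ec n1 a1 ac aj; rewrite -subr_ge0.
pose s := j - a; have s0 : 0 <= s by rewrite subr_ge0.
have Ej : j = a + s by rewrite /s; ring.
rewrite -/s; pose P := (N + 2 * s) * (N + 2 * j).
have P0 : 0 < P by rewrite mulr_gt0 //; lra.
have -> : (c - a) * (2 / (N + 2 * s) - 2 / (N + 2 * j)) + a * (2 / N - 2 / (N + 2 * j)) -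
    a * (1 / N - (n - 1) * (4 / (N * (N + 2)))) =
    a / (N * P) * (4 * (c - a) * N + 4 * j * (N + 2 * s) - P + 4 * (n - 1) * (P / (N + 2))).
  rewrite /P Ej; field; rewrite !gt_eqF //; lra.
(* [j] is at least 1, so [P] is at least [N (N + 2)]. *)
have PN : N <= P / (N + 2).
  rewrite ler_pdivlMr; last by lra.
  by rewrite /P; nra.
rewrite mulr_ge0 // ?divr_ge0 ?mulr_ge0 //; try lra.
have : 0 <= (n - 1) * (P / (N + 2) - N) by rewrite mulr_ge0 //; lra.
rewrite /P Ej; nra.
Qed.

(** [b] stands for [n - 1]: one outer neighbour has degree excess [x], at least the clique size, and
    the other [b] have excess at least 1. The right side is the share left over by the clique, so
    this situation contradicts tightness. *)
Lemma common_room (N b x : rat) : 0 < N -> 1 <= b -> 2 * b <= N - 3 ->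
  N - 1 - 2 * b <= 2 * x -> 2 / (N + 2 * x) + b * (2 / (N + 2)) <= (1 + 2 * b) / N.
Proof.
move=> N0 b1 bN hx; pose E := 2 * N - 1 - 2 * b.
have E0 : 0 < E by rewrite /E; lra.
have hE : 2 / (N + 2 * x) <= 2 / E.
  by rewrite ler_pM2l // lef_pV2 ?posrE /E; lra.
apply: le_trans (lerD hE (lexx _)) _; rewrite -subr_ge0.
have -> : (1 + 2 * b) / N - (2 / E + b * (2 / (N + 2))) =
    (E * (N + 2 + 4 * b) - 2 * N * (N + 2)) / (N * (N + 2) * E).
  by field; rewrite !gt_eqF //; lra.
rewrite divr_ge0 ?mulr_ge0 // /E; try lra.
by nra.
Qed.

(** The right side minus the left, multiplied by [N (N + 2 t)], is [(N - 1 - 2 t)^2 / 2 + (N^2 - 1)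
    / 2 + 6 t^2]. *)
Lemma common_overlap (N t : rat) : 1 <= N -> 0 <= t ->
  (2 / (N + 2 * t) - 1 / N) * (4 * t + 1) <= 1.
Proof.
move=> N1 t0; rewrite -subr_ge0.
have -> : 1 - (2 / (N + 2 * t) - 1 / N) * (4 * t + 1) =
    (N * (N + 2 * t) - (N - 2 * t) * (4 * t + 1)) / (N * (N + 2 * t)).
  by field; rewrite !gt_eqF //; lra.
rewrite divr_ge0 ?mulr_ge0 //; try lra.
have := sqr_ge0 (N - 1 - 2 * t).
by nra.
Qed.

(** * Extending a coloring to a clique of vertices of minimum degree *)

Section TightStep.
Variables (T : finType) (A : {set T}) (e : rel T) (C : {set T}) (d : nat).
Hypothesis tightA : tight A e.
Hypothesis IH : forall (A' : {set T}) (e' : rel T) (f' : T -> rat),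
  (#|A'| < #|A|)%N -> good A' e' f' -> colorable A' e' f'.
Hypothesis sCA : C \subset A.
Hypothesis C_neq0 : C != set0.
Hypothesis C_clique : clique e C.
Hypothesis C_deg : {in C, forall w, dg e w = d}.
Hypothesis deg_min : {in A, forall u, (d <= dg e u)%N}.

Let se : symmetric e. Proof. by case: tightA. Qed.
Let ie : irreflexive e. Proof. by case: tightA. Qed.
Let edA : edges_in A e. Proof. by case: tightA. Qed.
Let CP u v : u \in C -> v \in C -> u != v -> e u v.
Proof. by move/cliqueP: C_clique; apply. Qed.

Let F : rat := 2 / (2 * d%:R + 1).
Let c := #|C|.
(** The number of neighbours that each vertex of [C] has outside [C]. *)
Let n := (d + 1 - c)%N.
Let D := (2 * #|T| + 1)`!.
Let Y w := [set u | e w u & u \notin C].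
Let a u := #|nb e u :&: C|.

Let D_gt0 : (0 < D)%N. Proof. exact: fact_gt0. Qed.

Let c_gt0 : (0 < c)%N. Proof. by rewrite card_gt0. Qed.

Let F_eq : F * (2 * d%:R + 1) = 2.
Proof. by rewrite /F divfK // gt_eqF // ltr_wpDl // mulr_ge0. Qed.

Let F_gt0 : 0 < F.
Proof. by rewrite divr_gt0 // ltr_wpDl // mulr_ge0. Qed.

Let demC w : w \in C -> dem e w = F.
Proof. by move=> wC; rewrite /dem C_deg. Qed.

Let dem_leF u : u \in A -> dem e u <= F.
Proof.
have [w wC] := set0Pn _ C_neq0.
by move=> uA; rewrite -(demC wC); apply: dem_le; rewrite C_deg // deg_min.
Qed.

Let nbA w u : e w u -> u \in A.
Proof. by rewrite se => /edA. Qed.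

Let cF_lt1 : c%:R * F < 1.
Proof.
case: tightA => _ _ _ /(_ C sCA C_clique) + _.
by rewrite (eq_bigr (fun=> F)) => [|w /demC//]; rewrite sumr_const -[F *+ _]mulr_natl.
Qed.

(** Already [d + 1] vertices of demand [F] have total demand [(2 d + 2) / (2 d + 1)], above 1. *)
Let cd : (c <= d)%N.
Proof.
rewrite leqNgt; apply/negP; rewrite -(ler_nat rat) -natr1 => h.
have := cF_lt1; have := F_gt0; have := F_eq.
have h1 : (d%:R + 1) * F <= c%:R * F by rewrite ler_pM2r.
by lra.
Qed.

Let nc : (n + c = d + 1)%N. Proof. by have := cd; rewrite /n; lia. Qed.

Let n_gt0 : (0 < n)%N. Proof. by have := cd; rewrite /n; lia. Qed.

Let card_Y w : w \in C -> #|Y w| = n.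
Proof.
move=> wC; apply/eqP; rewrite -(eqn_add2r c) nc -(C_deg wC) eq_sym.
by apply/eqP; apply: card_nb_out.
Qed.

Let sum_nb (g : T -> rat) w : w \in C ->
  \sum_(u | e w u) g u = \sum_(u in Y w) g u + \sum_(u in C :\ w) g u.
Proof.
move=> wC; rewrite (bigID (fun u => u \in C)) /= addrC; congr (_ + _).
  by apply: eq_bigl => u; rewrite inE.
apply: eq_bigl => u; rewrite !inE; case: (eqVneq u w) => [->|uw] /=; first by rewrite ie.
by case uC : (u \in C); rewrite ?andbF // CP // eq_sym.
Qed.

(** The outer neighbours of [v] may block more than the share [1 - c F] that [finish] allows. The
    excess over 1 shown here is what each case below has to recover. *)
Let overflow v : v \in C -> 1 < \sum_(u in Y v) dem e u + c%:R * F.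
Proof.
move=> vC; case: tightA => _ _ _ _ /(_ v (subsetP sCA v vC)).
rewrite sum_nb // demC // (eq_bigr (fun=> F) (P := fun u => u \in C :\ v)); last first.
  by move=> w /setD1P[_ /demC].
rewrite sumr_const -[F *+ _]mulr_natl /c (cardsD1 v C) vC add1n -natr1.
by lra.
Qed.

(** Divisibility by [D] makes [F * #|Om|] an integer [q], and minimality of [d] bounds every outer
    demand by [F]. With [F (2 d + 1) = 2] this meets the hypotheses of [complete_clique]. *)
Lemma finish (Om : finType) (psi : T -> {set Om}) :
  (0 < #|Om|)%N -> (D %| #|Om|)%N -> proper e psi ->
  {in A :\: C, forall u, #|psi u|%:R = dem e u * #|Om|%:R} ->
  (forall u, u \notin A :\: C -> psi u = set0) ->
  #|blocked e C psi|%:R <= (1 - c%:R * F) * #|Om|%:R ->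
  colorable A e (dem e).
Proof.
move=> Om0 DM pp hf h0 hB.
have [w0 w0C] := set0Pn _ C_neq0.
have [q qP] := fact_dem e w0 DM; rewrite demC // in qP.
have [||w u wC ewu||psi' [p1 n1 c1]] :=
    complete_clique (d := d) (q := q) (C := C) se ie pp CP _ C_deg.
- by move=> w wC; rewrite h0 // !inE wC.
- apply/eqP; rewrite -(eqr_nat rat) !natrM natrD natrM qP mulrA -[_ * F]mulrC.
  by rewrite F_eq.
- have [uC|uC] := boolP (u \in C); first by rewrite h0 ?cards0 // !inE uC.
  rewrite -(ler_nat rat) qP hf; last by rewrite inE uC (nbA ewu).
  by rewrite ler_wpM2r // dem_leF // (nbA ewu).
- rewrite -(ler_nat rat) natrD natrM qP.
  by move: hB; rewrite -/c; lra.
exists Om, psi'; split => // u uA.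
have [uC|uC] := boolP (u \in C); first by rewrite c1 // demC // qP.
by rewrite n1 // hf // inE uC.
Qed.

Let blk_le (Om : finType) (psi : T -> {set Om}) v : v \in C ->
  {in C, forall w, psi w = set0} ->
  (#|blk e psi v| <= \sum_(u in Y v) #|psi u|)%N.
Proof.
move=> vC h0; apply: leq_trans (card_bigcup_le _ _) _.
rewrite (bigID (fun u => u \in C)) /= big1 ?add0n => [|u /andP[_ uC]]; last first.
  by rewrite h0 ?cards0.
by apply/eq_leq/eq_bigl => u; rewrite inE.
Qed.

(** Colours blocked on all of [C] come from [Y v], which misses [U] and carries no surplus. Dropping
    the surplus of [U] can therefore lower their number by the full overflow at [v]. *)
Lemma finish_trim (Om : finType) (psi : T -> {set Om}) (U : {set T}) (g : T -> rat) v :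
  (0 < #|Om|)%N -> (D %| #|Om|)%N -> proper e psi ->
  {in A :\: C, forall u, #|psi u|%:R = g u * #|Om|%:R} ->
  (forall u, u \notin A :\: C -> psi u = set0) ->
  v \in C -> {in U, forall y, [/\ y \in A :\: C, ~~ e v y & exists2 w, w \in C & e w y]} ->
  {in A :\: C, forall u, u \notin U -> g u = dem e u} ->
  {in U, forall y, dem e y <= g y} ->
  (forall y u, y \in U -> u \in A :\: C -> u != y -> g u <= F) ->
  \sum_(u in Y v) dem e u + c%:R * F - 1 <= \sum_(y in U) (g y - dem e y) ->
  colorable A e (dem e).
Proof.
move=> Om0 DM pp hf h0 vC hU gU gge gF hsum.
have h0C : {in C, forall w, psi w = set0} by move=> w wC; rewrite h0 // !inE wC.
have [k kP] := fin_all_exists (fun u => fact_dem e u DM).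
have [w0 w0C] := set0Pn _ C_neq0.
have [q qP] := fact_dem e w0 DM; rewrite demC // in qP.
have tq : (c * q <= #|Om|)%N.
  rewrite -(ler_nat rat) natrM qP mulrA ler_piMl // ltW //.
have kpsi : {in U, forall y, (k y <= #|psi y|)%N}.
  move=> y yU; have [yAC _ _] := hU y yU.
  by rewrite -(ler_nat rat) kP hf // ler_wpM2r // gge.
have [||y w yU wC ewy||psi' [s1 n1 c1 b1]] :=
    trim_blocked (e := e) (psi := psi) (C := C) (U := U) (k := k) (t := #|Om| - c * q).
- exact: kpsi.
- by move=> y /hU[].
- have [yAC _ _] := hU y yU.
  have yw : y \in Y w by rewrite inE ewy; case/setDP: yAC.
  have -> : (\sum_(u | e w u && (u != y)) #|psi u| = \sum_(u in Y w :\ y) #|psi u|)%N.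
    rewrite (bigID (fun u => u \in C)) /= big1 ?add0n => [|u /andP[_ uC]]; last first.
      by rewrite h0C ?cards0.
    by apply: eq_bigl => u; rewrite !inE -andbA andbC -andbA; congr (_ && _); rewrite andbC.
  (* The other [n - 1] outer neighbours of [w] and the [c] vertices of [C] make [d] portions of [q],
     and [d F] is below 1. *)
  apply: (@leq_trans ((n - 1) * q)); last first.
    rewrite -(ler_nat rat) (natrB _ tq).
    rewrite !natrM qP (natrB _ n_gt0).
    have : n%:R + c%:R = d%:R + 1 :> rat by rewrite -natrD nc natrD.
    have := F_gt0; have := F_eq; have : 0 < #|Om|%:R :> rat by rewrite ltr0n.
    move: #|Om|%:R n%:R c%:R d%:R F => M n' c' d' F' M0 E1 F0 E2.
    have -> : c' = d' + 1 - n' by rewrite -E2; ring.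
    have -> : (n' - 1) * (F' * M) = M * ((n' - 1) * F') by ring.
    have -> : M - (d' + 1 - n') * (F' * M) = M * (1 - (d' + 1 - n') * F') by ring.
    by rewrite ler_pM2l //; lra.
  rewrite -(card_Y wC) (cardsD1 y (Y w)) yw add1n subn1 /= -sum_nat_const.
  apply: leq_sum => u; rewrite !inE => /and3P[uy ewu uC].
  have uAC : u \in A :\: C by rewrite inE uC (nbA ewu).
  by rewrite -(ler_nat rat) hf // qP ler_wpM2r // (gF y).
- have sB : (#|blocked e C psi| <= \sum_(u in Y v) #|psi u|)%N.
    apply: leq_trans (blk_le vC h0C); apply: subset_leq_card; exact: bigcap_inf.
  apply: leq_trans sB _; rewrite -(ler_nat rat) natrD natrB // natrM qP !natr_sum.
  rewrite (eq_bigr (fun u => dem e u * #|Om|%:R)) => [|u]; last first.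
    rewrite inE => /andP[evu uC]; have uAC : u \in A :\: C by rewrite inE uC (nbA evu).
    by rewrite hf // gU //; apply/negP => /hU[_ /negP].
  rewrite [X in _ <= _ + X](eq_bigr (fun y => (g y - dem e y) * #|Om|%:R)) => [|y yU]; last first.
    by have [yAC _ _] := hU y yU; rewrite natrB ?kpsi // hf // kP mulrBl.
  rewrite -!mulr_suml.
  have : 0 <= #|Om|%:R :> rat by [].
  move: hsum; move: (\sum_(u in Y v) _) (\sum_(y in U) _) (#|Om|%:R) => x z M h M0.
  have := ler_wpM2r M0 h; lra.
apply: (@finish Om psi') => //.
- exact: proper_sub pp.
- move=> u uAC; have [uU|uU] := boolP (u \in U); first by rewrite c1 // kP.
  by rewrite n1 // hf // gU.
- by move=> u uAC; apply/eqP; rewrite -subset0 -(h0 u uAC).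
- rewrite mulrBl mul1r -mulrA -qP -natrM -natrB //.
  by rewrite ler_nat.
Qed.

(** * Degree excess and the overflow at a clique vertex *)

Let N : rat := 2 * d%:R + 1.
Let N_gt0 : 0 < N. Proof. by rewrite /N ltr_wpDl // mulr_ge0. Qed.
Let Nm_gt0 (m : nat) : 0 < N + 2 * m%:R.
Proof. by rewrite ltr_wpDr // mulr_ge0. Qed.
Let j u := (dg e u - d)%N.

Let dem_j u : u \in A -> dem e u = 2 / (N + 2 * (j u)%:R).
Proof.
move=> uA; rewrite /dem -(subnK (deg_min uA)) natrD /N; congr (_ / _).
by rewrite -/(j u); ring.
Qed.

Lemma deficit_sum (P : {set T}) : P \subset A ->
  F - 2 / (N + 2 * (\sum_(u in P) j u)%:R) <= \sum_(u in P) (F - dem e u).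
Proof.
move=> /subsetP sP.
elim/big_rec2: _ => [|u x y uP IHu]; first by rewrite mulr0 addr0 subrr.
rewrite natrD (dem_j (sP u uP)).
apply: le_trans (lerD (lexx _) IHu).
by apply: deficit_subadd.
Qed.

Let YA v : Y v \subset A.
Proof. by apply/subsetP => u; rewrite inE => /andP[/nbA]. Qed.

(** Since [n + c = d + 1], demand [F] on all of [Y v] and [C] would total [1 + 1 / N]. From this the
    outer deficits are subtracted, which together are at least the deficit of one vertex with the
    summed excess. *)
Lemma overflow_le v : v \in C ->
  \sum_(u in Y v) dem e u + c%:R * F - 1 <=
  2 / (N + 2 * (\sum_(u in Y v) j u)%:R) - 1 / N.
Proof.
move=> vC; have := deficit_sum (YA v).
rewrite sumrB sumr_const -[F *+ _]mulr_natl card_Y //.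
have : n%:R + c%:R = d%:R + 1 :> rat by rewrite -natrD nc natrD.
have : F = 2 * (1 / N) by rewrite /F -/N; field; rewrite gt_eqF.
have := F_eq.
move: (\sum_(u in Y v) _) (2 / (_ + _)) (1 / N) => x z w E1 E2 E3 h.
have : (n%:R + c%:R) * F = (d%:R + 1) * F by rewrite E3.
lra.
Qed.

Let a_lt y : (a y < c)%N -> exists2 v, v \in C & ~~ e y v.
Proof.
move=> ayc; have : ~~ (C \subset nb e y).
  by apply: contraTN ayc => /setIidPr h; rewrite /a h -leqNgt.
by case/subsetPn => v vC; rewrite inE => eyv; exists v.
Qed.

Let a_gt y : (0 < a y)%N -> exists2 v, v \in C & e y v.
Proof.
rewrite card_gt0 => /set0Pn[v]; rewrite !inE => /andP[eyv vC].
by exists v.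
Qed.

Let a_le y : (a y <= dg e y)%N.
Proof. by rewrite subset_leq_card ?subsetIl. Qed.

Let card_nbD y : (#|nb e y :\: C| = dg e y - a y)%N.
Proof. by rewrite cardsD. Qed.

Let dvd_deg M : (D %| M)%N -> (2 * d + 1 %| M)%N.
Proof.
apply: dvdn_trans; apply: dvdn_fact.
have [w wC] := set0Pn _ C_neq0; rewrite -(C_deg wC).
have : (dg e w <= #|T|)%N by apply: max_card.
by clear; lia.
Qed.

Lemma color_low y : y \in A :\: C -> (0 < a y < c)%N -> (dg e y < d + a y)%N ->
  colorable A e (dem e).
Proof.
move=> /setDP[yA yC] /andP[ay0 ayc] dy.
have [v vC neyv] := a_lt ayc.
have gd := good_restr (y |: C) (tight_good tightA).
have lA : (#|A :\: (y |: C)| < #|A|)%N.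
  by apply: (subset_proper_card yA); rewrite !inE eqxx.
have [Om [psi [Om0 DM pp hf h0]]] := colorable_exact (IH lA gd) (good_ge0 gd) D_gt0.
have {}pp : proper e psi.
  by apply: proper_restr pp _ => u uS; rewrite h0 // inE uS.
have [r Mr] := dvdnP (dvd_deg DM).
have rF : r%:R = F / 2 * #|Om|%:R.
  rewrite Mr natrM natrD natrM /F; field.
  by rewrite gt_eqF // -/N.
have [k kP] := fact_dem e y DM.
have kr : (k <= 2 * r)%N.
  rewrite -(ler_nat rat) kP natrM rF.
  have := ler_wpM2r (ler0n _ #|Om|) (dem_leF yA); lra.
have y0 : psi y = set0 by rewrite h0 // !inE eqxx.
pose b u := if u == y then (k + r)%N else #|psi u|.
have [u|w|psi' [p1 n1 s1 c1]] := greedy_fill (b := b) (W := [set y]) se ie pp.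
- by rewrite /b; case: eqP => // ->; rewrite y0 cards0.
- move=> /set1P ->; rewrite {2}/b eqxx.
  have : (\sum_(u | e y u) b u <= (dg e y - a y) * (2 * r))%N.
    rewrite -card_nbD -sum_nat_const.
    rewrite (bigID (fun u => u \in C)) /= big1 ?add0n => [|u /andP[eyu uC]]; last first.
      rewrite /b ifN; last by apply: contraTneq eyu => ->; rewrite ie.
      by rewrite h0 ?cards0 // !inE uC orbT.
    rewrite (eq_bigl [in nb e y :\: C]) => [|u]; last by rewrite !inE andbC.
    apply: leq_sum => u; rewrite !inE => /andP[uC eyu].
    have uy : u != y by apply: contraTneq eyu => ->; rewrite ie.
    rewrite /b (negPf uy) -(ler_nat rat) hf ?inE ?negb_or ?uy ?uC ?(nbA eyu) //.
    rewrite natrM rF.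
    have := ler_wpM2r (ler0n _ #|Om|) (dem_leF (nbA eyu)); lra.
  (* At most [d - 1] neighbours with [2 r] colours each, and [k + r <= 3 r] colours for [y], fit
     into [#|Om| = (2 d + 1) r]. *)
  have : (dg e y - a y <= d - 1)%N.
    by move: dy ay0; clear; lia.
  have d1 : (0 < d)%N by apply: leq_trans cd.
  rewrite Mr; move: kr d1; move: (dg e y - a y)%N (\sum_(u | _) _)%N; clear.
  move=> x s kr d1 lx ls.
  have [d' Ed] : exists d', d = d'.+1 by exists d.-1; lia.
  subst d; rewrite subn1 /= in lx.
  by nia.
pose g u := if u == y then dem e y + F / 2 else dem e u.
have nAC u : u \in A :\: C -> u != y -> u \in A :\: (y |: C).
  by rewrite !inE => /andP[uC ->] uy; rewrite negb_or uy uC.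
apply: (@finish_trim Om psi' [set y] g v) => //.
- move=> u uAC; rewrite /g; case: eqP => [->|/eqP uy].
    by rewrite c1 ?inE // /b eqxx natrD kP rF mulrDl.
  by rewrite n1 ?inE // hf // nAC.
- move=> u uAC; rewrite n1 ?h0 //.
    by apply: contra uAC; rewrite !inE negb_or => /andP[/andP[_ ->] ->].
  by rewrite inE; apply: contraNneq uAC => ->; rewrite inE yC.
- move=> z /set1P->; split; first by rewrite inE yC.
    by rewrite se.
  by have [w wC eyw] := a_gt ay0; exists w => //; rewrite se.
- by move=> u uAC; rewrite inE /g => /negPf->.
- by move=> z /set1P->; rewrite /g eqxx; have := F_gt0; lra.
- move=> z u /set1P-> /setDP[uA _] uy; rewrite /g (negPf uy); exact: dem_leF.
(* Even full demand [F] on [Y v] overflows by only [1 / N = F / 2], the surplus given to [y]. *)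
- rewrite big_set1 /g eqxx.
  have : \sum_(u in Y v) dem e u <= \sum_(u in Y v) F.
    by apply: ler_sum => u /(subsetP (YA v)); apply: dem_leF.
  rewrite sumr_const -[F *+ _]mulr_natl card_Y //.
  have : n%:R + c%:R = d%:R + 1 :> rat by rewrite -natrD nc natrD.
  have := F_eq; move: (\sum_(u in Y v) _) => x E1 E2.
  have : (n%:R + c%:R) * F = (d%:R + 1) * F by rewrite E2.
  lra.
Qed.

(** Once [color_low] is ruled out, an outer neighbour of degree [d] would have to see all of [C],
    and a maximal [C] admits none. *)
Hypothesis j_gt0 : forall u, u \notin C -> (0 < a u)%N -> (d < dg e u)%N.

Let a_Y v u : v \in C -> u \in Y v -> (0 < a u)%N.
Proof.
move=> vC; rewrite inE => /andP[evu _]; rewrite card_gt0; apply/set0Pn.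
by exists v; rewrite !inE vC se evu.
Qed.

Let j_ge1 v u : v \in C -> u \in Y v -> (1 <= j u)%N.
Proof.
move=> vC uY; rewrite subn_gt0; apply: j_gt0; last exact: a_Y uY.
by move: uY; rewrite inE => /andP[].
Qed.

Let del v := \sum_(u in Y v) dem e u + c%:R * F - 1.

Let del_gt0 v : v \in C -> 0 < del v.
Proof. by move=> /overflow; rewrite /del; lra. Qed.

(** The summed excess over [Y v] is at least that of [y]. The bound lets a reserved set of share
    [del v] fit inside the colours of [y]. *)
Let del_le v y : v \in C -> y \in Y v -> del v <= dem e y.
Proof.
move=> vC yY; have yA := subsetP (YA v) y yY.
apply: le_trans (overflow_le vC) _; rewrite (dem_j yA).
apply: (@le_trans _ _ (2 / (N + 2 * (\sum_(u in Y v) j u)%:R))).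
  by rewrite lerBlDr lerDl divr_ge0 // ltW.
rewrite ler_pM2l // lef_pV2 ?posrE ?Nm_gt0 //.
by rewrite lerD2l ler_pM2l // ler_nat (bigD1 y) //= leq_addr.
Qed.

(** A reserved set [Z] is given to [y] and stays free at a non-neighbour [w] of [y] in [C]. So no
    colour of [Z] is blocked on all of [C], which recovers [del v] at a neighbour [v] of [y]. The
    clique hypothesis leaves room to complete [y]. *)
Lemma color_outer_clique y : y \in A :\: C -> (0 < a y < c)%N ->
  clique e (y |: (nb e y :\: C)) -> colorable A e (dem e).
Proof.
move=> /setDP[yA yC] /andP[ay0 ayc] cQ.
have [w wC neyw] := a_lt ayc; have [v vC eyv] := a_gt ay0.
have yYv : y \in Y v by rewrite inE se eyv.
pose S := y |: C.
have sS : S \subset A by rewrite subUset sub1set yA.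
have yw : y != w by apply: contraNneq yC => ->.
pose t := (\sum_(u in Y v) j u)%N.
have tj : (j y + (n - 1) <= t)%N.
  rewrite /t (big_setD1 y) //= leq_add2l -(card_Y vC) (cardsD1 y (Y v)) yYv.
  rewrite add1n subn1 /= -sum1_card; apply: leq_sum => u /setD1P[_ uY].
  exact: j_ge1 uY.
have cD : (#|(nb e y :|: nb e w) :\: S| <= dg e y - a y + n)%N.
  rewrite -card_nbD -(card_Y wC); apply: leq_trans (leq_card_setU _ _).1.
  apply/subset_leq_card/subsetP => u; rewrite !inE negb_or => /andP[/andP[uy uC]].
  by rewrite uC /= andbT.
have d0 := ltW (del_gt0 vC).
(* The merged vertex has degree at most [d + t], as [a y] is positive, and [del v (N + 2 t)] is at
   most [2 - (N + 2 t) / N]. *)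
have hdel : del v * (2 * #|(nb e y :|: nb e w) :\: S|%:R + 1) <= 1.
  apply: (@le_trans _ _ (del v * (N + 2 * t%:R))).
    rewrite ler_wpM2l // /N.
    have : (#|(nb e y :|: nb e w) :\: S| <= d + t)%N.
      move: cD tj n_gt0 ay0 (deg_min yA) (a_le y); rewrite /j; clear; lia.
    by rewrite -(ler_nat rat) natrD; lra.
  apply: le_trans (ler_wpM2r _ (overflow_le vC)) _.
    by rewrite addr_ge0 ?mulr_ge0 // ltW.
  rewrite -/t mulrBl divfK; last by rewrite gt_eqF // ltr_wpDr // mulr_ge0.
  rewrite mulrDr div1r mulVf ?gt_eqF //.
  have : 0 <= N^-1 * (2 * t%:R) by rewrite !mulr_ge0 // invr_ge0 ltW.
  by lra.
have [||Om [psi [Z [[Om0 DM pp] hf h0 cZ dZ]]]] :=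
  pair_gadget tightA IH sS _ _ yw d0 hdel D_gt0; rewrite ?inE ?eqxx ?wC ?orbT //.
have [k kP] := fact_dem e y DM.
pose psi1 u := if u == y then Z else psi u.
have pp1 : proper e psi1.
  have dZ' u : e y u -> [disjoint Z & psi u].
    move=> eyu; have [uS|uS] := boolP (u \in S).
      by rewrite (h0 u) ?disjoint_set0 // inE uS.
    by apply: dZ => //; rewrite eyu.
  move=> u x eux; rewrite /psi1; case: eqP => [uy|_]; case: eqP => [xy|_].
  - by move: eux; rewrite uy xy ie.
  - by apply: dZ'; rewrite -uy.
  - by rewrite disjoint_sym; apply: dZ'; rewrite -xy se.
  - exact: pp.
have Zk : (#|Z| <= k)%N by rewrite -(ler_nat rat) cZ kP ler_wpM2r // del_le.
pose b u := if u == y then k else #|psi u|.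
have [u|x|psi' [p1 n1 s1 c1]] := greedy_fill (b := b) (W := [set y]) se ie pp1.
- by rewrite /b /psi1; case: eqP.
- move=> /set1P->; rewrite {2}/b eqxx -(ler_nat rat) natrD kP natr_sum.
  case: (tightA) => _ _ _ /(_ (y |: (nb e y :\: C))) + _; rewrite subUset sub1set yA.
  move=> /(_ (subset_trans (subsetDl _ _) (nb_sub y se edA)) cQ)/ltW.
  rewrite big_setU1 /=; last by rewrite !inE ie andbF.
  move=> h; rewrite (bigID (fun u => u \in C)) /= big1 ?add0r => [|u /andP[eyu uC]]; last first.
    rewrite /b ifN; last by apply: contraTneq eyu => ->; rewrite ie.
    by rewrite h0 ?cards0 // !inE uC orbT.
  rewrite (eq_bigl [in nb e y :\: C]) => [|u]; last by rewrite !inE andbC.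
  rewrite (eq_bigr (fun u => dem e u * #|Om|%:R)) => [|u]; last first.
    rewrite !inE => /andP[uC eyu].
    have uy : u != y by apply: contraTneq eyu => ->; rewrite ie.
    by rewrite /b (negPf uy) hf // !inE negb_or uy uC (nbA eyu).
  by rewrite -mulr_suml -mulrDl addrC ler_piMl.
have h0' u : u \notin A :\: C -> psi' u = set0.
  move=> uAC; have uy : u != y by apply: contraNneq uAC => ->; rewrite inE yC.
  rewrite n1 ?inE // /psi1 (negPf uy) h0 //.
  by apply: contra uAC; rewrite !inE negb_or => /andP[/andP[_ ->] ->].
have hf' : {in A :\: C, forall u, #|psi' u|%:R = dem e u * #|Om|%:R}.
  move=> u /setDP[uA uC]; have [->|uy] := eqVneq u y.
    by rewrite c1 ?inE // /b eqxx kP.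
  by rewrite n1 ?inE // /psi1 (negPf uy) hf // !inE negb_or uy uC.
have yZ : Z \subset psi' y.
  by have := s1 y; rewrite /psi1 eqxx.
have ZB : [disjoint Z & blk e psi' w].
  rewrite disjoint_sym disjoints_subset; apply/bigcupsP => u ewu.
  have [uC|uC] := boolP (u \in C); first by rewrite h0' ?sub0set // inE uC.
  have uy : u != y by apply: contraNneq neyw => <-; rewrite se.
  rewrite n1 ?inE // /psi1 (negPf uy) -disjoints_subset disjoint_sym.
  by apply: dZ; rewrite ?ewu ?orbT // !inE negb_or uy uC.
apply: (@finish Om psi') => //.
have sB : blocked e C psi' \subset
    \bigcup_(u in Y v :\ y) psi' u :|: (psi' y :\: Z).
  apply/subsetP => x xB; have /bigcupP[u evu xu] := subsetP (bigcap_inf _ vC) x xB.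
  have xZ : x \notin Z.
    by rewrite (disjointFl ZB) // (subsetP (bigcap_inf _ wC)).
  rewrite inE; have [uy|uy] := eqVneq u y; first by rewrite inE xZ -uy xu orbT.
  apply/orP; left; apply/bigcupP; exists u => //; rewrite !inE uy evu /=.
  by apply: contraTN xu => uC; rewrite h0' ?inE ?uC.
apply: (@le_trans _ _ (\sum_(u in Y v :\ y) #|psi' u| + (#|psi' y| - #|Z|))%:R).
  rewrite ler_nat; apply: leq_trans (subset_leq_card sB) _.
  apply: leq_trans (leq_card_setU _ _).1 _; rewrite -cardsDS // leq_add2r.
  exact: card_bigcup_le.
rewrite natrD natrB ?subset_leq_card // natr_sum cZ hf'; last by rewrite inE yC.
rewrite (eq_bigr (fun u => dem e u * #|Om|%:R)) => [|u]; last first.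
  by rewrite !inE => /and3P[_ evu uC]; rewrite hf' // inE uC (nbA evu).
rewrite -mulr_suml -mulrBl -mulrDl ler_wpM2r // /del (big_setD1 y yYv) /=.
by lra.
Qed.

(** Tightness keeps clique sums below 1 and closed neighbourhood sums above 1. *)
Let closed_nb_not_clique v : v \in A -> ~~ clique e (v |: nb e v).
Proof.
move=> vA; apply/negP => cl; case: tightA => _ _ _ hK hv.
have := hv v vA; have := hK (v |: nb e v).
rewrite subUset sub1set vA nb_sub // big_setU1 ?inE ?ie //= (eq_bigl (e v)).
  by move=> /(_ isT cl); lra.
by move=> u; rewrite inE.
Qed.

(** All vertices of [C] have the same outer neighbours, and two of these, [y1] and [y2], are
    nonadjacent. Putting [Z] into both makes the count of blocked colours include [Z] once instead
    of twice. *)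
Lemma color_common : (forall u, u \notin C -> (0 < a u)%N -> a u = c) ->
  colorable A e (dem e).
Proof.
move=> full; have [v vC] := set0Pn _ C_neq0.
have vA := subsetP sCA v vC.
have adj u w : u \in Y v -> w \in C -> e u w.
  move=> uY wC; have uC : u \notin C by move: uY; rewrite inE => /andP[].
  have E : nb e u :&: C = C.
    by apply/eqP; rewrite eqEcard subsetIr /= -/(a u) (full u uC (a_Y vC uY)).
  by have : w \in nb e u :&: C; [rewrite E | rewrite !inE => /andP[]].
have sub_Y u : u \in v |: nb e v -> u \notin C -> u \in Y v.
  by rewrite !inE => /predU1P[->|->//]; rewrite vC.
have [y1 [y2 [y1Y y2Y y12 ney]]] :
    exists y1 y2, [/\ y1 \in Y v, y2 \in Y v, y1 != y2 & ~~ e y1 y2].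
  have := closed_nb_not_clique vA; rewrite negb_forall => /existsP[y1].
  rewrite negb_imply negb_forall => /andP[y1N /existsP[y2]].
  rewrite !negb_imply => /and3P[y2N y12 ney].
  have y1C : y1 \notin C.
    apply: contra ney => y1C; have [y2C|y2C] := boolP (y2 \in C); first exact: CP.
    by rewrite se; apply: adj => //; apply: sub_Y.
  have y2C : y2 \notin C.
    by apply: contra ney => y2C; apply: adj => //; apply: sub_Y.
  by exists y1, y2; split => //; apply: sub_Y.
pose W := [set y1; y2]; pose S := W :|: C.
have WY u : u \in W -> u \in Y v by move=> /set2P[->|->].
have YC u : u \in Y v -> u \notin C by rewrite inE => /andP[].
have WA u : u \in W -> u \in A by move=> /WY; apply: (subsetP (YA v)).
have sS : S \subset A by rewrite subUset sCA andbT; apply/subsetP => u /WA.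
have y1W : y1 \in W by rewrite !inE eqxx.
have y2W : y2 \in W by rewrite !inE eqxx orbT.
have y1S : y1 \in S by rewrite inE y1W.
have y2S : y2 \in S by rewrite inE y2W.
pose R := Y v :\ y1 :\ y2.
have sumY (g : T -> rat) : \sum_(u in Y v) g u = g y1 + (g y2 + \sum_(u in R) g u).
  by rewrite (big_setD1 y1) //= (big_setD1 y2) // in_setD1 y2Y eq_sym y12.
have cR : (#|R| + 2 = n)%N.
  rewrite -(card_Y vC) (cardsD1 y1 (Y v)) y1Y (cardsD1 y2 (Y v :\ y1)).
  by rewrite in_setD1 y2Y eq_sym y12 /=; rewrite addnC.
pose t := (\sum_(u in Y v) j u)%N.
have tj : (j y1 + j y2 + (n - 2) <= t)%N.
  rewrite /t (big_setD1 y1) //= (big_setD1 y2) /=; last by rewrite in_setD1 y2Y eq_sym y12.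
  rewrite -addnA !leq_add2l -cR addnK -sum1_card; apply: leq_sum => u uR.
  by apply: (j_ge1 vC); move: uR; rewrite !in_setD1 => /and3P[].
(* By [common_room], an excess of [c] or more at [y] would contradict [overflow]. The bound leaves
   [y] at most [d - 1] neighbours outside [C], hence room for its own demand. *)
have room y : y \in W -> (dg e y + 1 <= c + d)%N.
  move=> yW; have yY := WY y yW; have yA := WA y yW; rewrite leqNgt; apply/negP => hlt.
  have := overflow vC; rewrite (big_setD1 y) //= (dem_j yA).
  have lR : \sum_(u in Y v :\ y) dem e u <= (n%:R - 1) * (2 / (N + 2)).
    have -> : (n%:R - 1) = #|Y v :\ y|%:R :> rat.
      by rewrite -(card_Y vC) (cardsD1 y (Y v)) yY add1n -natr1 addrK.
    rewrite [leRHS]mulr_natl -[leRHS]sumr_const; apply: ler_sum => u /setD1P[_ uY].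
    rewrite (dem_j (subsetP (YA v) u uY)) ler_pM2l // lef_pV2 ?posrE ?Nm_gt0 //; last first.
      by have := N_gt0; lra.
    rewrite lerD2l -[leLHS]mulr1 ler_pM2l // -[1]/(1%:R) ler_nat.
    exact: j_ge1 uY.
  have hn : n%:R + c%:R = d%:R + 1 :> rat by rewrite -natrD nc natrD.
  have n2 : 2 <= n%:R :> rat by rewrite (ler_nat _ 2) -cR leq_addl.
  have c1 : 1 <= c%:R :> rat by rewrite (ler_nat _ 1).
  have hj : d%:R + 1 - n%:R <= (j y)%:R :> rat.
    rewrite lerBlDr natr1 -natrD ler_nat.
    by move: hlt nc (deg_min yA); rewrite /j; clear; lia.
  have := @common_room N (n%:R - 1) (j y)%:R N_gt0.
  have -> : c%:R * F = 1 - (1 + 2 * (n%:R - 1)) / N.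
    have -> : c%:R = d%:R + 1 - n%:R :> rat by rewrite -hn; ring.
    by rewrite /F /N; field; rewrite gt_eqF // -/N.
  move: lR; set x := \sum_(u in _) _; set z := 2 / (N + 2 * _).
  set p := (n%:R - 1) * _; set q := _ / N => lx h1 h2.
  have : z + p <= q by apply: h1; rewrite /N; lra.
  by lra.
have aW u : u \in W -> a u = c.
  by move=> /WY uY; apply: full (YC _ uY) (a_Y vC uY).
(* The degrees outside [C] add up to [2 (n - 1) + j y1 + j y2], while [t] is at least
   [j y1 + j y2 + n - 2] and both excesses are at least 1. *)
have cD : (#|(nb e y1 :|: nb e y2) :\: S| <= 2 * t)%N.
  have : (#|(nb e y1 :|: nb e y2) :\: S| <= (dg e y1 - a y1) + (dg e y2 - a y2))%N.
    rewrite -!card_nbD.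
    apply: leq_trans (leq_card_setU _ _).1.
    apply/subset_leq_card/subsetP => u /setDP[uN uS].
    have uC : u \notin C by apply: contraNN uS => uC; rewrite in_setU uC orbT.
    by move: uN; rewrite !inE uC.
  rewrite !aW //; have := j_ge1 vC y1Y; have := j_ge1 vC y2Y.
  move: tj nc cd cR (deg_min (WA y1 y1W)) (deg_min (WA y2 y2W)); rewrite /j; clear; lia.
have d0 := ltW (del_gt0 vC).
have hdel : del v * (2 * #|(nb e y1 :|: nb e y2) :\: S|%:R + 1) <= 1.
  apply: (@le_trans _ _ (del v * (4 * t%:R + 1))).
    rewrite ler_wpM2l //.
    by move: cD; rewrite -(ler_nat rat) natrM; lra.
  apply: le_trans (ler_wpM2r _ (overflow_le vC)) _; first by rewrite addr_ge0 ?mulr_ge0.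
  apply: common_overlap => //; rewrite /N.
  by rewrite -[leLHS]add0r lerD2r mulr_ge0.
have [Om [psi [Z [[Om0 DM pp] hf h0 cZ dZ]]]] :=
  pair_gadget tightA IH sS y1S y2S y12 d0 hdel D_gt0.
have [k kP] := fin_all_exists (fun u => fact_dem e u DM).
pose psi1 u := if u \in W then Z else psi u.
have nW u x : u \in W -> e u x -> x \notin W.
  rewrite !inE => /orP[/eqP->|/eqP->] eux; apply/negP => /orP[/eqP|/eqP] E;
    by move: eux ney; rewrite E ?ie // se => ->.
have pp1 : proper e psi1.
  have dZ' u x : u \in W -> e u x -> [disjoint Z & psi x].
    move=> uW eux; have [xS|xS] := boolP (x \in S).
      by rewrite (h0 x) ?disjoint_set0 // inE xS.
    apply: dZ => //; move: uW eux; rewrite !inE => /orP[/eqP->|/eqP->] ->//.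
    by rewrite orbT.
  move=> u x eux; rewrite /psi1; case: ifP => uW; case: ifP => xW.
  - by have := nW _ _ uW eux; rewrite xW.
  - exact: dZ' eux.
  - by rewrite disjoint_sym; apply: (dZ' x) => //; rewrite se.
  - exact: pp.
pose b u := if u \in W then k u else #|psi u|.
have Zk u : u \in W -> (#|Z| <= k u)%N.
  by move=> uW; rewrite -(ler_nat rat) cZ kP ler_wpM2r // del_le // WY.
have [q qP] := fact_dem e v DM; rewrite demC // in qP.
have Mq : (d * q <= #|Om|)%N.
  rewrite -(ler_nat rat) natrM qP mulrA ler_piMl //.
  by have := F_eq; have := F_gt0; lra.
have kq u : u \in A -> (k u <= q)%N.
  by move=> uA; rewrite -(ler_nat rat) kP qP ler_wpM2r // dem_leF.
have [u|x xW|psi' [p1 n1 s1 c1]] := greedy_fill (b := b) (W := W) se ie pp1.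
- by rewrite /b /psi1; case: ifP => // /Zk.
- have : (\sum_(u | e x u) b u <= (dg e x - c) * q)%N.
    rewrite -(aW x xW) -card_nbD -sum_nat_const.
    rewrite (bigID (fun u => u \in C)) /= big1 ?add0n => [|u /andP[exu uC]]; last first.
      by rewrite /b ifN ?(nW x) // h0 ?cards0 // in_setD in_setU uC orbT.
    rewrite (eq_bigl [in nb e x :\: C]) => [|u]; last by rewrite !inE andbC.
    apply: leq_sum => u; rewrite !inE => /andP[uC exu].
    rewrite /b ifN ?(nW x) //; apply: leq_trans (kq u (nbA exu)).
    rewrite -(ler_nat rat) kP hf // in_setD in_setU negb_or uC (nW x) //=.
    exact: nbA exu.
  have := room x xW; have := kq x (WA x xW); rewrite {3}/b xW.
  move: Mq cd; move: (\sum_(u | _) _)%N (k x) (dg e x); clear.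
  move=> s kx g Mq cd lk hg ls.
  have [g' Eg] : exists g', d = (g - c + 1 + g')%N by exists (d - (g - c + 1))%N; lia.
  rewrite Eg in Mq; nia.
have h0' u : u \notin A :\: C -> psi' u = set0.
  move=> uAC; have uW : u \notin W.
    by apply: contraNN uAC => uW; rewrite in_setD WA // YC // WY.
  rewrite n1 // /psi1 (negPf uW) h0 //.
  by apply: contra uAC; rewrite !in_setD in_setU negb_or => /andP[/andP[_ ->] ->].
have hf' : {in A :\: C, forall u, #|psi' u|%:R = dem e u * #|Om|%:R}.
  move=> u /setDP[uA uC]; have [uW|uW] := boolP (u \in W).
    by rewrite c1 // /b uW kP.
  by rewrite n1 // /psi1 (negPf uW) hf // in_setD in_setU negb_or uW uC.
have WZ u : u \in W -> Z \subset psi' u.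
  by move=> uW; have := s1 u; rewrite /psi1 uW.
apply: (@finish Om psi') => //.
have sB : blocked e C psi' \subset
    psi' y1 :|: ((psi' y2 :\: Z) :|: \bigcup_(u in R) psi' u).
  apply/subsetP => x xB; have /bigcupP[u evu xu] := subsetP (bigcap_inf _ vC) x xB.
  rewrite !in_setU; have [uy1|uy1] := eqVneq u y1; first by rewrite -uy1 xu.
  have [uy2|uy2] := eqVneq u y2.
    case xZ : (x \in Z); first by rewrite (subsetP (WZ y1 y1W)).
    by rewrite in_setD xZ -uy2 xu orbT.
  apply/orP; right; apply/orP; right; apply/bigcupP; exists u => //.
  rewrite !in_setD1 uy1 uy2 inE evu /=.
  by apply: contraTN xu => uC; rewrite h0' ?inE ?uC.
apply: (@le_trans _ _ (#|psi' y1| + ((#|psi' y2| - #|Z|) + \sum_(u in R) #|psi' u|))%:R).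
  rewrite ler_nat; apply: leq_trans (subset_leq_card sB) _.
  apply: leq_trans (leq_card_setU _ _).1 _; rewrite leq_add2l.
  apply: leq_trans (leq_card_setU _ _).1 _; rewrite -cardsDS ?WZ // leq_add2l.
  exact: card_bigcup_le.
rewrite !natrD natrB ?subset_leq_card ?WZ // natr_sum cZ.
rewrite !hf' ?in_setD ?YC ?WA //.
rewrite (eq_bigr (fun u => dem e u * #|Om|%:R)) => [|u]; last first.
  rewrite !in_setD1 => /and3P[_ _ uY]; rewrite hf' // in_setD YC //.
  exact: (subsetP (YA v)).
rewrite -mulr_suml -mulrBl -!mulrDl ler_wpM2r // /del sumY.
by lra.
Qed.

(** * Raising demands outside the clique and averaging over it *)

Let e' := restr e C.

Let dg' u : u \notin C -> dg e' u = (dg e u - a u)%N.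
Proof. by move=> uC; rewrite /dg nb_restr // card_nbD. Qed.

Let double_count (h : T -> rat) :
  \sum_(v in C) \sum_(u in Y v) h u = \sum_(u | u \notin C) (a u)%:R * h u.
Proof.
rewrite (exchange_big_dep (fun u => u \notin C)) /=; last first.
  by move=> v u _; rewrite inE => /andP[].
apply: eq_bigr => u uC.
rewrite (eq_bigl [in nb e u :&: C]) => [|v]; last by rewrite !inE uC andbT se andbC.
by rewrite sumr_const mulr_natl.
Qed.

Let inc := [set u | (u \notin C) && (0 < a u < c)%N].

Let Y_a v u : v \in C -> u \in Y v = (u \notin C) && (v \in nb e u :&: C).
Proof. by move=> vC; rewrite !inE vC andbT andbC se. Qed.

(** Fewer than [n] vertices see all of [C], since [y0] takes a place in some [Y w]. So each vertex
    of [C] has a neighbour in [inc], and the sum counts the edges between [C] and [inc]. *)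
Let inc_weight y0 : y0 \in inc -> c%:R <= \sum_(u in inc) (a u)%:R :> rat.
Proof.
move=> y0i; pose full := [set u | (u \notin C) && (a u == c)].
have fullY v : v \in C -> full \subset Y v.
  move=> vC; apply/subsetP => u; rewrite inE => /andP[uC /eqP auc]; rewrite Y_a // uC /=.
  have -> // : nb e u :&: C = C.
  by apply/eqP; rewrite eqEcard subsetIr /= -/(a u) auc.
have Yinc v u : v \in C -> u \in Y v -> u \notin full -> u \in inc.
  move=> vC uY; have a0 := a_Y vC uY; move: uY; rewrite inE => /andP[_ uC].
  rewrite [u \in full]inE uC /= => ac; rewrite inE uC a0 ltn_neqAle ac.
  by rewrite subset_leq_card ?subsetIr.
have lt_full : (#|full| < n)%N.
  move: (y0i); rewrite inE => /and3P[y0C a0 ac]; have [w wC ey] := a_gt a0.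
  rewrite -(card_Y wC); apply: proper_card; rewrite properE fullY //=.
  apply/subsetPn; exists y0; first by rewrite inE se ey.
  by rewrite inE y0C /= neq_ltn ac.
have one v : v \in C -> 1 <= \sum_(u in Y v) (u \in inc)%:R :> rat.
  move=> vC; have : ~~ (Y v \subset full).
    by apply: contraTN lt_full => /subset_leq_card; rewrite card_Y // -leqNgt.
  case/subsetPn => u uY uf; rewrite (big_setD1 u) //= (Yinc v u) // lerDl.
  exact: sumr_ge0.
have : \sum_(v in C) (1 : rat) <= \sum_(v in C) \sum_(u in Y v) (u \in inc)%:R.
  exact: ler_sum.
rewrite sumr_const double_count => h; apply: le_trans h _.
rewrite big_mkcond [leRHS]big_mkcond /=; apply: ler_sum => u _.
rewrite [u \in inc]inE; case: (u \notin C) => //=; case: (_ && _) => /=.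
  by rewrite mulr1.
by rewrite mulr0.
Qed.

(** This is what remains after [color_low]; it keeps the degrees of these vertices at least [d] when
    [C] is deleted. *)
Hypothesis inc_deg : {in inc, forall u, (d + a u <= dg e u)%N}.

Let gain y := dem e' y - dem e y.

(** The deficit [2 / N - 2 / (N + 2)] of a vertex of degree [d + 1]. *)
Let gamma : rat := 4 / (N * (N + 2)).

Let hnc : n%:R + c%:R = d%:R + 1 :> rat.
Proof. by rewrite -natrD nc natrD. Qed.

Let aA u : (0 < a u)%N -> u \in A.
Proof. by case/a_gt => v vC; apply: edA. Qed.

Let deficit_ge u : u \notin C -> (0 < a u)%N -> gamma <= F - dem e u.
Proof.
move=> uC a0; rewrite (dem_j (aA a0)) /F -/N.
have j1 : 1 <= (j u)%:R :> rat.
  by rewrite (ler_nat _ 1) subn_gt0 j_gt0.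
have N2 : 0 < N + 2 by have := N_gt0; lra.
apply: (@le_trans _ _ (2 / N - 2 / (N + 2))).
  by rewrite /gamma le_eqVlt; apply/orP; left; apply/eqP; field; rewrite !gt_eqF.
by rewrite lerD2l lerN2 ler_pM2l // lef_pV2 ?posrE ?Nm_gt0 //; lra.
Qed.

(** Each of the [n] outer neighbours of a vertex of [C] has deficit at least [gamma], and by
    [overflow] something of [1 / N] is left after subtracting them. *)
Let gamma_n : 0 <= 1 / N - n%:R * gamma.
Proof.
have [v vC] := set0Pn _ C_neq0; have := overflow vC.
have : \sum_(u in Y v) dem e u <= \sum_(u in Y v) (F - gamma).
  apply: ler_sum => u uY; have := a_Y vC uY; move: (uY); rewrite inE => /andP[_ uC] a0.
  by have := deficit_ge uC a0; lra.
rewrite sumr_const -[(F - gamma) *+ _]mulr_natl card_Y // => h1 h2.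
have E : F = 2 * (1 / N) by rewrite /F -/N; field; rewrite gt_eqF.
have : (n%:R + c%:R) * F = (d%:R + 1) * F by rewrite hnc.
by have := F_eq; lra.
Qed.

Let gain_ge u : u \in inc ->
  (a u)%:R * (1 / N - n%:R * gamma) + (a u)%:R * gamma <=
  (c%:R - (a u)%:R) * gain u + (a u)%:R * (F - dem e u).
Proof.
move=> ui; move: (ui); rewrite inE => /and3P[uC a0 ac].
have da := inc_deg ui; have uA := aA a0.
have -> : gain u = 2 / (N + 2 * ((j u)%:R - (a u)%:R)) - 2 / (N + 2 * (j u)%:R).
  rewrite /gain (dem_j uA) /dem dg' // natrB ?a_le //; congr (2 / _ - _).
  by rewrite -(subnK (deg_min uA)) -/(j u) natrD /N; ring.
rewrite (dem_j uA) /F -/N.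
apply: le_trans (@raise_gain N n%:R c%:R (a u)%:R (j u)%:R N_gt0 _ _ _ _ _).
- by rewrite le_eqVlt; apply/orP; left; apply/eqP; rewrite /gamma; ring.
- by rewrite /N; have := hnc; lra.
- by rewrite (ler_nat _ 1).
- by rewrite (ler_nat _ 1).
- by rewrite natr1 ler_nat.
- by rewrite ler_nat /j leq_subRL ?deg_min.
Qed.

(* Averaging over [C]: a colour released by a neighbour of one vertex of [C] helps every
   other vertex of [C]. *)
Lemma exists_gain y0 : y0 \in inc -> exists2 v, v \in C &
  \sum_(u in Y v) dem e u + c%:R * F - 1 <= \sum_(y in [set y in inc | ~~ e v y]) gain y.
Proof.
move=> y0i; apply/exists_inP; apply: contraT => /exists_inPn h; exfalso.
have [w0 w0C] := set0Pn _ C_neq0.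
have : \sum_(v in C) \sum_(y in [set y in inc | ~~ e v y]) gain y <
    \sum_(v in C) (\sum_(u in Y v) dem e u + c%:R * F - 1).
  apply: ltr_sum; last by move=> v vC; rewrite ltNge h.
  by apply/hasP; exists w0; rewrite ?mem_index_enum.
have -> : \sum_(v in C) (\sum_(u in Y v) dem e u + c%:R * F - 1) =
    \sum_(u | u \notin C) (a u)%:R * dem e u + c%:R * (c%:R * F) - c%:R.
  rewrite big_split big_split /= double_count !sumr_const -/c mulNrn.
  by rewrite [c%:R * (c%:R * F)]mulr_natl.
have -> : \sum_(v in C) \sum_(y in [set y in inc | ~~ e v y]) gain y =
    \sum_(y in inc) (c%:R - (a y)%:R) * gain y.
  rewrite (exchange_big_dep [in inc]) /=; last by move=> v y _; rewrite inE => /andP[].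
  apply: eq_bigr => y yi.
  rewrite (eq_bigl [in C :\: nb e y]) => [|v]; last first.
    by rewrite [y \in _]inE yi !inE se andbC.
  rewrite sumr_const cardsD setIC -/(a y) -/c -[LHS]mulr_natl natrB //.
  by rewrite subset_leq_card ?subsetIr.
have W : \sum_(u | u \notin C) (a u)%:R = n%:R * c%:R :> rat.
  have := double_count (fun=> 1); under [RHS]eq_bigr do rewrite mulr1.
  move=> <-; rewrite (eq_bigr (fun=> n%:R)); last first.
    by move=> v vC; rewrite sumr_const card_Y.
  by rewrite sumr_const mulr_natr.
(* Vertices of [inc] contribute by [gain_ge], the others by their deficit alone. With [inc_weight]
   and total weight [n c] the left side is at least [c / N], the overflow summed over [C] before
   deficits. *)
have key : \sum_(u in inc) (a u)%:R * (1 / N - n%:R * gamma) +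
      \sum_(u | u \notin C) (a u)%:R * gamma <=
    \sum_(u in inc) (c%:R - (a u)%:R) * gain u +
      \sum_(u | u \notin C) (a u)%:R * (F - dem e u).
  rewrite (big_mkcond [in inc]) [\sum_(u | _) _ * gamma]big_mkcond -big_split /=.
  rewrite [X in _ <= X + _]big_mkcond [X in _ <= _ + X]big_mkcond -big_split /=.
  apply: ler_sum => u _; have [ui|ui] := boolP (u \in inc).
    by have := ui; rewrite inE => /andP[uC _]; rewrite uC; apply: gain_ge.
  rewrite !add0r; case: ifP => // uC.
  have [a0|a0] := posnP (a u); first by rewrite a0 !mul0r.
  by rewrite ler_wpM2l // deficit_ge.
have sumF : \sum_(u | u \notin C) (a u)%:R * (F - dem e u) =
    n%:R * c%:R * F - \sum_(u | u \notin C) (a u)%:R * dem e u.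
  by rewrite -W mulr_suml -sumrB; apply: eq_bigr => u _; rewrite mulrBr.
move: key; rewrite -!mulr_suml W sumF => key.
have kw := ler_wpM2r gamma_n (inc_weight y0i).
have E : F = 2 * (1 / N) by rewrite /F -/N; field; rewrite gt_eqF.
have E2 : c%:R * ((n%:R + c%:R) * F) = c%:R * ((d%:R + 1) * F) by rewrite hnc.
have E3 : c%:R * (F * (2 * d%:R + 1)) = c%:R * 2 by rewrite F_eq.
move: key kw E E2 E3; move: (\sum_(u in inc) _ * gain u) (\sum_(u in inc) _).
move: (\sum_(u | _) _) (1 / N) gamma F n%:R c%:R d%:R => s iN g F' n' c' d' x z.
move=> key kw E E2 E3 hx; rewrite E in key E2 E3 hx.
lra.
Qed.

Lemma color_raise y0 : y0 \in inc ->
  {in inc, forall y, ~~ clique e (y |: (nb e y :\: C))} -> colorable A e (dem e).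
Proof.
move=> y0i ncl; have [v vC hv] := exists_gain y0i.
pose U := [set y in inc | ~~ e v y].
pose g u := if u \in U then dem e' u else dem e u.
have Ui u : u \in U -> u \in inc by rewrite inE => /andP[].
have UC u : u \in U -> u \notin C by move=> /Ui; rewrite inE => /andP[].
have dem_e' u : u \notin C -> dem e u <= dem e' u.
  by move=> uC; apply/dem_le/dg_restr_le.
have gd : good (A :\: C) e' g.
  split.
  - exact: restr_sym.
  - exact: restr_irr.
  - exact: restr_edges.
  - by move=> u _; rewrite /g; case: ifP => _; apply/ltW/dem_gt0.
  - by move=> u /setDP[uA uC]; rewrite /g; case: ifP => // _; apply: dem_e'.
  (* A clique of sum at least 1 would be the closed neighbourhood of a light vertex: in [e'] if that
     vertex is in [U], excluded by hypothesis, and otherwise in [e], excluded by tightness. *)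
  - move=> K sK cK; rewrite leNgt; apply/negP => /ltW sum1.
    have K0 : K != set0 by apply: contraTneq sum1 => ->; rewrite big_set0 ler10.
    pose gg u := if u \in U then dg e' u else dg e u.
    have [u uK du] : exists2 u, u \in K & (gg u < #|K|)%N.
      apply: (light_vertex K0); apply: le_trans sum1 _; rewrite le_eqVlt.
      by apply/orP; left; apply/eqP/eq_bigr => u _; rewrite /g /gg; case: ifP.
    have /setDP[uA uC] := subsetP sK u uK.
    move: du; rewrite /gg; case: ifP => [uU|_] du.
      have EK := clique_closed_nb (restr_irr C ie) cK uK du.
      case/negP: (ncl u (Ui u uU)); rewrite -nb_restr // -EK.
      exact: restr_clique cK.
    have cKe := restr_clique cK.
    have EK := clique_closed_nb ie cKe uK du.
    by case/negP: (closed_nb_not_clique uA); rewrite -EK.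
have [w wC] := set0Pn _ C_neq0.
have lA : (#|A :\: C| < #|A|)%N by apply: (subset_proper_card (subsetP sCA w wC)).
have [Om [psi [Om0 DM pp hf h0]]] := colorable_exact (IH lA gd) (good_ge0 gd) D_gt0.
have {}pp : proper e psi.
  by apply: proper_restr pp _ => u uC; rewrite h0 // inE uC.
apply: (@finish_trim Om psi U g v) => //.
- move=> y yU; have := Ui y yU; rewrite inE => /and3P[yC a0 _].
  split; first by rewrite inE yC aA.
    by move: yU; rewrite inE => /andP[].
  by have [x xC eyx] := a_gt a0; exists x => //; rewrite se.
- by move=> u _ /negPf uU; rewrite /g uU.
- by move=> y yU; rewrite /g yU; apply/dem_e'/UC.
- move=> y u _ /setDP[uA uC] _; rewrite /g; case: ifP => uU; last exact: dem_leF.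
  rewrite -(demC wC); apply: dem_le; rewrite C_deg // dg' //.
  by rewrite leq_subRL ?a_le // addnC inc_deg // Ui.
- apply: le_trans hv _; rewrite le_eqVlt; apply/orP; left; apply/eqP/eq_bigr => y yU.
  by rewrite /g yU.
Qed.

End TightStep.

Lemma tight_colorable (T : finType) (A : {set T}) (e : rel T) : tight A e ->
  (forall (A' : {set T}) (e' : rel T) (f' : T -> rat),
     (#|A'| < #|A|)%N -> good A' e' f' -> colorable A' e' f') ->
  colorable A e (dem e).
Proof.
move=> ti IH; have [se ie ed hK hv] := ti.
have [A0|[v1 v1A]] := set_0Vmem A.
  exists 'I_1, (fun=> set0); split; first by rewrite card_ord.
    by move=> u v _; apply: disjoint_set0.
  by move=> v; rewrite A0 inE.
have [v0 v0A dmin] : exists2 v0, v0 \in A & {in A, forall u, (dg e v0 <= dg e u)%N}.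
  by case: (arg_minnP (dg e) v1A) => v0 v0A dmin; exists v0.
pose d := dg e v0.
pose P (X : {set T}) := [&& X \subset A, clique e X & [forall w in X, dg e w == d]].
have P0 : P [set v0].
  rewrite /P sub1set v0A /=; apply/andP; split.
    by apply/cliqueP => u v /set1P-> /set1P->; rewrite eqxx.
  by apply/forall_inP => w /set1P->.
have [C /maxsetP[/and3P[sCA Ccl /forall_inP Cd] Cmax] v0C] := maxset_exists P0.
have {}Cd : {in C, forall w, dg e w = d} by move=> w /Cd/eqP.
have C0 : C != set0 by apply/set0Pn; exists v0; rewrite -sub1set.
have {v0C}v0C : v0 \in C by rewrite -sub1set.
have C_max y : y \notin C -> dg e y = d -> ~ {in C, forall w, e w y}.
  move=> yC dy hy; have yA : y \in A by apply: (ed y v0); rewrite se hy.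
  have /Cmax : P (y |: C).
    rewrite /P subUset sub1set yA sCA /=; apply/andP; split.
      apply/cliqueP => u w /setU1P[->|uC] /setU1P[->|wC]; rewrite ?eqxx // => uw.
      - by rewrite se hy.
      - exact: hy.
      - by move/cliqueP: Ccl; apply.
    by apply/forall_inP => w /setU1P[->|/Cd->]; rewrite ?dy.
  by move=> /(_ (subsetUr _ _)) E; case/negP: yC; rewrite -E setU11.
pose a u := #|nb e u :&: C|.
pose inc u := (u \notin C) && (0 < a u < #|C|)%N.
have incA u : inc u -> u \in A :\: C.
  case/and3P => uC; rewrite card_gt0 => /set0Pn[w]; rewrite !inE => /andP[euw _] _.
  by rewrite uC (ed _ _ euw).
(* This case comes first because its failure supplies [inc_deg] and, with maximality of [C],
   [j_gt0]. *)
case: (pickP (fun y => inc y && (dg e y < d + a y)%N)) => [y /andP[yi dy]|nolow].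
  have /andP[_ ya] := yi.
  exact: (color_low ti IH sCA C0 Ccl Cd dmin (incA y yi) ya dy).
have inc_deg u : inc u -> (d + a u <= dg e u)%N.
  by move=> ui; have := nolow u; rewrite ui /= => /negbT; rewrite -leqNgt.
have j_gt0 u : u \notin C -> (0 < a u)%N -> (d < dg e u)%N.
  move=> uC a0; have [ac|ac] := ltnP (a u) #|C|.
    by have := inc_deg u; rewrite /inc uC a0 ac => /(_ isT); move: a0; clear; lia.
  have uA : u \in A.
    move: a0; rewrite card_gt0 => /set0Pn[w]; rewrite !inE => /andP[euw _].
    exact: ed euw.
  rewrite ltn_neqAle dmin // andbT; apply/eqP => Ed; apply: (C_max u uC) => // w wC.
  have EC : nb e u :&: C = C by apply/eqP; rewrite eqEcard subsetIr.
  by have : w \in nb e u :&: C; [rewrite EC | rewrite !inE se => /andP[]].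
case: (pickP (fun y => inc y && clique e (y |: (nb e y :\: C)))) => [y /andP[yi cy]|nocl].
  have /andP[_ ya] := yi.
  exact: (color_outer_clique ti IH sCA C0 Ccl Cd dmin j_gt0 (incA y yi) ya cy).
case: (pickP inc) => [y yi|noinc].
  apply: (color_raise ti IH sCA C0 Ccl Cd dmin j_gt0 _ (y0 := y)).
  - by move=> u; rewrite inE => /inc_deg.
  - by rewrite inE.
  - move=> u; rewrite inE => ui; have := nocl u.
    by rewrite /inc /a ui /= => ->.
apply: (color_common ti IH sCA C0 Ccl Cd dmin j_gt0) => u uC a0.
have := noinc u; rewrite /inc uC a0 /= => /negbT; rewrite -leqNgt => ac.
by apply/eqP; rewrite eqn_leq ac subset_leq_card ?subsetIr.
Qed.

Theorem good_colorable (T : finType) (A : {set T}) (e : rel T) f :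
  good A e f -> colorable A e f.
Proof.
have [m] := ubnP #|A|; elim: m A e f => // m IHm A e f lm gd.
have IH : forall (A' : {set T}) (e' : rel T) (f' : T -> rat),
    (#|A'| < #|A|)%N -> good A' e' f' -> colorable A' e' f'.
  by move=> A' e' f' l; apply: IHm; apply: leq_trans l _.
by apply: (reduce_to_tight IH) => // ti; apply: tight_colorable.
Qed.

(** * Measurable colorings *)

Require Import Defs.
From mathcomp Require Import all_classical all_reals all_analysis.
Local Open Scope classical_set_scope.

Section Cells.
Variables (R : realType) (M : nat).
Hypothesis M_gt0 : (0 < M)%N.

(** Half-open, so that neighbouring cells share no endpoint. *)
Definition cell (i : 'I_M) : set (measurableTypeR R) :=
  `[(i%:R / M%:R : R), (i.+1%:R / M%:R : R)[.

Let M0 : 0 < M%:R :> R. Proof. by rewrite ltr0n. Qed.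

Lemma cell_measurable i : measurable (cell i).
Proof. exact: measurable_itv. Qed.

Lemma cell_measure i : lebesgue_measure (cell i) = (M%:R^-1)%:E.
Proof.
rewrite /cell lebesgue_measure_itv /= lte_fin ltr_pM2r ?invr_gt0 // ltr_nat leqnn.
by rewrite -EFinB -mulrBl -natr1 addrAC subrr add0r mul1r.
Qed.

Lemma cell_disjoint i k x : cell i x -> cell k x -> i = k.
Proof.
rewrite /cell /= !in_itv /= !ler_pdivrMr // !ltr_pdivlMr // => /andP[a1 a2] /andP[b1 b2].
apply/val_inj/eqP; rewrite eqn_leq; apply/andP; split; rewrite -ltnS -(ltr_nat R).
  exact: le_lt_trans a1 b2.
exact: le_lt_trans b1 a2.
Qed.

Lemma cell_unit i : cell i `<=` `[0%R, 1%R].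
Proof.
move=> x; rewrite /cell /= !in_itv /= => /andP[a1 a2].
rewrite (le_trans _ a1) ?divr_ge0 //= (le_trans (ltW a2)) // ler_pdivrMr // mul1r.
by rewrite ler_nat.
Qed.

Lemma mem_cells (P : pred 'I_M) x :
  (\big[setU/set0]_(i < M | P i) cell i) x -> exists2 i, P i & cell i x.
Proof.
elim/big_rec: _ => // i S Pi IH [ix|/IH//].
by exists i.
Qed.

Lemma cells_measure (P : pred 'I_M) :
  lebesgue_measure (\big[setU/set0]_(i < M | P i) cell i) =
  (\sum_(i < M | P i) M%:R^-1)%:E.
Proof.
rewrite measure_bigsetU_ord.
- by rewrite -sumEFin; apply: eq_bigr => i _; apply: cell_measure.
- exact: cell_measurable.
- apply/trivIsetP => i k _ _ ik; rewrite -subset0 => x [ix kx].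
  by move/eqP: ik; apply; apply: cell_disjoint kx.
Qed.

End Cells.

Lemma colorable_f_coloring (R : realType) (T : finType) (e : rel T) (f : T -> rat) :
  colorable (finset.setTfor T) e f ->
  exists phi : T -> set (measurableTypeR R), f_coloring e f phi.
Proof.
move=> [Om [psi [Om0 pp hf]]].
pose P v (i : 'I_#|Om|) := enum_val i \in psi v.
exists (fun v => \big[setU/set0]_(i < #|Om| | P v i) @cell R #|Om| i).
split; first split.
- by move=> v; apply: bigsetU_measurable => i _; apply: cell_measurable.
- split=> [v x /mem_cells[i _]|u v euv].
    exact: cell_unit.
  rewrite -subset0 => x [/mem_cells[i ui ix] /mem_cells[k vk kx]].
  move: ui; rewrite (cell_disjoint Om0 ix kx) /P => uk.
  by move: vk; rewrite /P (disjointFr (pp u v euv)).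
move=> v; rewrite cells_measure // lee_fin.
have -> : \sum_(i < #|Om| | P v i) (#|Om|%:R^-1 : R) = #|psi v|%:R / #|Om|%:R.
  rewrite -(big_enum_val_cond (A := Om) [in psi v] (fun=> #|Om|%:R^-1)) /=.
  rewrite (eq_bigl [in psi v]) //.
  by rewrite sumr_const mulr_natl.
rewrite ler_pdivlMr ?ltr0n //.
by have := hf v (finset.in_setT v); rewrite -(ler_rat R) rmorphM /= !ratr_nat.
Qed.

Theorem theorem1p3 (R : realType) (eps : R) (T : finType) (e : rel T) (f : T -> rat) :
  eps <= 1 / 2 ->
  simple_graph e ->
  demand f ->
  (forall v, ratr (f v) <= 1 / ((deg e v)%:R + 1 - eps) :> R) ->
  (forall K : {set T}, is_clique e K -> \sum_(v in K) f v <= 1) ->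
  exists phi : T -> set (measurableTypeR R), f_coloring e f phi.
Proof.
move=> heps [se ie] hf hdeg hK; apply: colorable_f_coloring; apply: good_colorable.
split => //.
- by move=> v _; have /andP[] := hf v.
- move=> v _; rewrite -(ler_rat R); apply: le_trans (hdeg v) _.
  (* [deg] counts a classical set, [dg] a finite one. *)
  have -> : deg e v = dg e v.
    apply: eq_card => u; rewrite /nb finset.in_set.
    by apply/idP/idP => [/set_mem|h]; [|apply/mem_set].
  have -> : dem e v = 2 / (2 * dg e v + 1)%:R by rewrite /dem natrD natrM.
  rewrite fmorph_div /= !ratr_nat natrD natrM.
  have x0 : 0 <= (dg e v)%:R :> R by [].
  (* As [eps <= 1 / 2], the denominator [x + 1 - eps] is at least [x + 1 / 2], hence positive. *)
  move: (dg e v)%:R x0 => x x0; rewrite ler_pdivrMr; last by lra.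
  rewrite mulrAC ler_pdivlMr; last by lra.
  lra.
- by move=> K _ /cliqueP cK; apply: hK => u v; apply: cK.
Qed.
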